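(* Let $M_1,\ldots,M_s$ ($s\ge2$) be $m\times m$ positive semidefinite matrices such that $\sum_{k=1}^sM_k$ has full rank $m$, let $p\in[0,1]$, let $N$ be an integer with $1\le N\le s$, and let $\boldsymbol{w}^*$ be an optimal solution of the continuous problem $$\max\Big\{\Phi_p\big(M_F(\boldsymbol{w})\big):\ \boldsymbol{w}\in\mathbb{R}_+^s,\ \sum_{k=1}^sw_k\le N\Big\}.$$ Let $S\subseteq[s]$ be the set of indices obtained by selecting the $N$ largest coordinates of $\boldsymbol{w}^*$, and let $S^*$ be an optimal solution of the binary problem $\max\{\varphi_p(T):\ T\subseteq[s],\ |T|\le N\}$. If $p\le 1-\frac{\ln N}{\ln s}$, then $$\frac{\varphi_p(S)}{\varphi_p(S^* )}\ \ge\ \frac{\varphi_p(S)}{\varphi_p(\boldsymbol{w}^* )}\ \ge\ \Big(\frac Ns\Big)^{1-p}.$$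
   Context: $[s]:=\{1,\ldots,s\}$; positive semidefinite matrices are real symmetric. For $\boldsymbol{w}\in\mathbb{R}_+^s$, $M_F(\boldsymbol{w}):=\sum_{i=1}^sw_iM_i$. For an $m\times m$ positive semidefinite matrix $M$ with eigenvalues $\lambda_1,\dots,\lambda_m$ (with multiplicities), $\operatorname{trace}M^p:=\sum_k\lambda_k^p$ if $p\in(0,1]$ and $\operatorname{trace}M^0:=\operatorname{rank}M$. The criterion is $\Phi_p(M)=\big(\frac1m\operatorname{trace}M^p\big)^{1/p}$ for $p\in(0,1]$, and $\Phi_0(M)=(\det M)^{1/m}$. Moreover $\varphi_p(\boldsymbol{w}):=\operatorname{trace}M_F(\boldsymbol{w})^p$ for $\boldsymbol{w}\in\mathbb{R}_+^s$, and $\varphi_p(T):=\operatorname{trace}\big(\sum_{i\in T}M_i\big)^p$ for $T\subseteq[s]$ (both are ranks when $p=0$). Ties among the coordinates of $\boldsymbol{w}^*$ are broken arbitrarily when forming $S$ (so $|S|=N$). *)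

(* Defs.v *)
From HB Require Import structures.
From mathcomp Require Import all_boot all_order all_algebra.
From mathcomp Require Import polyrcf.
From mathcomp Require Import all_classical all_reals all_analysis.

Set Implicit Arguments.
Unset Strict Implicit.
Unset Printing Implicit Defensive.

Import Order.TTheory GRing.Theory Num.Theory.

Local Open Scope ring_scope.

Definition psd (R : realType) (m : nat) (A : 'M[R]_m) : Prop :=
  A^T = A /\ forall x : 'cV[R]_m, 0 <= (x^T *m A *m x) 0 0.

(* Real eigenvalues, each repeated according to its multiplicity as a root of
   the characteristic polynomial; for symmetric A these are all m of them. *)
Definition eigenvalues (R : realType) (m : nat) (A : 'M[R]_m) : seq R :=
  flatten [seq nseq (mup x (char_poly A)) x | x <- rootsR (char_poly A)].

(* The case p = 0 is kept apart since 0 `^ 0 = 1. *)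
Definition trace_pow (R : realType) (p : R) (m : nat) (A : 'M[R]_m) : R :=
  if p == 0 then (\rank A)%:R else \sum_(x <- eigenvalues A) x `^ p.

Definition Phi (R : realType) (p : R) (m : nat) (A : 'M[R]_m) : R :=
  if p == 0 then (\det A) `^ (m%:R^-1)
  else (m%:R^-1 * trace_pow p A) `^ (p^-1).

Definition info_mx (R : realType) (m s : nat) (M : 'I_s -> 'M[R]_m)
    (w : 'I_s -> R) : 'M[R]_m :=
  \sum_(i < s) w i *: M i.

Definition phi_design (R : realType) (p : R) (m s : nat)
    (M : 'I_s -> 'M[R]_m) (w : 'I_s -> R) : R :=
  trace_pow p (info_mx M w).

Definition phi_set (R : realType) (p : R) (m s : nat)
    (M : 'I_s -> 'M[R]_m) (T : {set 'I_s}) : R :=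
  trace_pow p (\sum_(i in T) M i).

Definition feasible_design (R : realType) (s N : nat) (w : 'I_s -> R) : Prop :=
  (forall i, 0 <= w i) /\ \sum_(i < s) w i <= N%:R.

Definition optimal_design (R : realType) (p : R) (m s N : nat)
    (M : 'I_s -> 'M[R]_m) (w : 'I_s -> R) : Prop :=
  feasible_design N w /\
  forall v : 'I_s -> R, feasible_design N v ->
    Phi p (info_mx M v) <= Phi p (info_mx M w).

Definition optimal_set (R : realType) (p : R) (m s N : nat)
    (M : 'I_s -> 'M[R]_m) (T : {set 'I_s}) : Prop :=
  (#|T| <= N)%N /\
  forall U : {set 'I_s}, (#|U| <= N)%N -> phi_set p M U <= phi_set p M T.

(* S consists of the indices of N largest coordinates of w, for some way of
   breaking ties. *)
Definition largest_coords (R : realType) (s N : nat) (w : 'I_s -> R)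
    (S : {set 'I_s}) : Prop :=
  #|S| = N /\ forall i j, i \in S -> j \notin S -> w j <= w i.

(* Main.v *)
Require Import Defs.
From HB Require Import structures.
From mathcomp Require Import all_boot all_order all_algebra.
From mathcomp Require Import polyrcf complex.
From mathcomp Require Import all_classical all_reals all_analysis.
From mathcomp Require Import ring lra zify.

Set Implicit Arguments.
Unset Strict Implicit.
Unset Printing Implicit Defensive.

Import Order.TTheory GRing.Theory Num.Theory.

Local Open Scope ring_scope.

(** Write X = sum_i w_i M_i. Since the criterion is concave, optimality of w
    makes X definite (for p < 1), saturates the budget, and equalizes
    tr (X^(p-1) M_i) over the support of w; call the common value a, so that
    phi_p (w) <= N a. The key inequality is

      sum_(i in S) w_i^(1-p) tr (X^(p-1) M_i) <= tr (sum_(i in S) M_i)^p.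

    For p = 0 it bounds a trace of a contraction by its rank. For 0 < p < 1,
    replace the weights on S by equal ones by raising all those at the
    current lowest level t to the next level. Splitting the matrix as
    t A + B, with A the lowest block, Loewner-Heinz says that
    tr ((tA+B)^(p-1) A) t^(1-p) increases with t, and integrating this along
    the derivative of tr (tA+B)^p shows that the left-hand side increases at
    each step; once all the weights are equal it is the right-hand side.
    It remains to bound sum_(i in S) w_i^(1-p) below by N (N/s)^(1-p), where
    concavity leaves the uniform and the one-point designs as extreme cases,
    and the condition on p says that the uniform one is the worst. *)

(** * Powers of scalars *)

Section Scalars.
Variable R : realType.
Implicit Types (p q x y a b t : R).

(** For 1 x 1 matrices the key inequality is Hölder's, sum w_i^(1-p) x_i <= (sum w_i x_i)^(1-p) (sum
    x_i)^p; the chain of levels replaces it because the [M i] need not commute with each other or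
    with X. The chain needs a definite matrix at every level, while every [M i] may be singular:
    hence a perturbation and a limit. Likewise the first-order conditions cannot be written at X
    before X is known to be definite, so they are derived at nearby definite points of a segment and
    then passed to the limit. Derivatives and integrals of traces are avoided: concavity enters
    through tangent inequalities (Klein), integration through a subdivision argument. The condition
    on p reads N <= s^(1-p), that is N (N/s)^(1-p) <= N^(1-p), which compares the sums over S for
    the uniform and the one-point designs. For p = 1 the criterion is linear and X may be singular,
    so the argument breaks down; but then the condition forces N = 1 and traces are compared
    directly. *)

Lemma powR_le1D p y : 0 < p <= 1 -> 0 <= y -> y `^ p <= 1 + p * (y - 1).
Proof.
move=> /andP[p0 p1] y0; have [->|pn1] := eqVneq p 1.
  by rewrite powRr1//; lra.
have q0 : 0 < 1 - p by rewrite subr_gt0 lt_neqAle pn1.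
(* Young's inequality for the product of y^p and 1, with conjugate exponents 1/p and 1/(1-p). *)
have := @conjugate_powR R (y `^ p) 1 p^-1 (1 - p)^-1 (powR_ge0 _ _) ler01.
rewrite !invr_gt0 !invrK => /(_ p0 q0); rewrite addrC subrK => /(_ erefl).
rewrite -powRrM mulfV ?gt_eqF// powRr1// powR1 mulr1 mul1r.
by move=> h; apply: (le_trans h); lra.
Qed.

Lemma powR_tangent p x y : 0 < p <= 1 -> 0 < x -> 0 <= y ->
  y `^ p <= x `^ p + p * x `^ (p - 1) * (y - x).
Proof.
move=> hp x0 y0; have := powR_le1D hp (divr_ge0 y0 (ltW x0)).
rewrite -(ler_pM2l (powR_gt0 p x0)) -powRM ?divr_ge0 ?(ltW x0)//.
rewrite [x * _]mulrC divfK ?gt_eqF//; move/le_trans; apply.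
rewrite -(mulr_powRB1 (ltW x0)); last by case/andP: hp.
by rewrite le_eqVlt; apply/orP; left; apply/eqP; field; rewrite gt_eqF.
Qed.

Lemma ln_tangent x y : 0 < x -> 0 < y -> ln y <= ln x + x^-1 * (y - x).
Proof.
move=> x0 y0; have := ln_sublinear (divr_gt0 y0 x0).
have := expR_ge1Dx (ln (y / x)).
rewrite lnK ?posrE ?divr_gt0// ln_div ?posrE//.
move=> h _; have -> : x^-1 * (y - x) = y / x - 1 by field; rewrite gt_eqF.
lra.
Qed.

Lemma powR_concave q a b t : 0 < q <= 1 -> 0 <= a -> 0 <= b -> 0 <= t <= 1 ->
  t * a `^ q + (1 - t) * b `^ q <= (t * a + (1 - t) * b) `^ q.
Proof.
move=> hq a0 b0 /andP[t0 t1]; have q0 : 0 < q by case/andP: hq.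
have : 0 <= t * a + (1 - t) * b by rewrite addr_ge0 ?mulr_ge0 ?subr_ge0.
rewrite le_eqVlt => /orP[/eqP h|].
  have ta0 : 0 <= t * a by rewrite mulr_ge0.
  have tb0 : 0 <= (1 - t) * b by rewrite mulr_ge0 ?subr_ge0.
  have : t * a = 0 by lra.
  have : (1 - t) * b = 0 by lra.
  move=> /eqP; rewrite mulf_eq0 => hb /eqP; rewrite mulf_eq0 => ha.
  have -> : t * a `^ q = 0.
    by case/orP: ha => /eqP->; rewrite ?mul0r// powR0 ?mulr0 ?gt_eqF.
  have -> : (1 - t) * b `^ q = 0.
    by case/orP: hb => /eqP->; rewrite ?mul0r// powR0 ?mulr0 ?gt_eqF.
  by rewrite addr0 powR_ge0.
set c := t * a + _ => c0.
have := ler_wpM2l t0 (powR_tangent hq c0 a0).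
have t1' : 0 <= 1 - t by rewrite subr_ge0.
have := ler_wpM2l t1' (powR_tangent hq c0 b0).
move=> h1 h2; apply: le_trans (lerD h2 h1) _.
rewrite le_eqVlt; apply/orP; left; apply/eqP; rewrite /c.
set u := _ `^ (q - 1); set v := _ `^ q; ring.
Qed.

(** Over n equal steps the total decrease is at most n C ((b - a)/n)^2, which tends to 0. This
    stands in for integrating a nonnegative derivative. *)
Lemma le_of_quadratic_decrease (f : R -> R) (C a b : R) : a <= b ->
  (forall x y, a <= x -> x <= y -> y <= b -> f x - f y <= C * (y - x) ^+ 2) ->
  f a <= f b.
Proof.
move=> ab h; rewrite leNgt; apply/negP => fab.
have C0 : 0 <= C * (b - a) ^+ 2 by apply: le_trans (h a b _ _ _); rewrite // subr_ge0 ltW.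
have [n hn] : exists n : nat, C * (b - a) ^+ 2 / (f a - f b) < n.+1%:R.
  exists (Num.trunc (C * (b - a) ^+ 2 / (f a - f b))).
  by rewrite truncnS_gt.
have fab' : 0 < f a - f b by rewrite subr_gt0.
move: hn; rewrite ltr_pdivrMr// ltNge => /negP; apply.
have n0 : 0 < n.+1%:R :> R by rewrite ltr0n.
pose x k : R := a + (b - a) * k%:R / n.+1%:R.
have step k : (k <= n.+1)%N -> f a - f (x k) <= k%:R * (C * (b - a) ^+ 2 / n.+1%:R ^+ 2).
  elim: k => [|k IH] hk; first by rewrite /x mulr0 mul0r addr0 subrr mul0r.
  have := IH (ltnW hk).
  have : f (x k) - f (x k.+1) <= C * (x k.+1 - x k) ^+ 2.
    apply: h; rewrite /x.
    - by rewrite lerDl divr_ge0 ?mulr_ge0 ?subr_ge0.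
    - by rewrite lerD2l ler_pM2r ?invr_gt0// ler_wpM2l ?subr_ge0// ler_nat.
    - rewrite -lerBrDl -mulrA ler_piMr ?subr_ge0//.
      by rewrite ler_pdivrMr// mul1r ler_nat.
  have -> : x k.+1 - x k = (b - a) / n.+1%:R.
    rewrite /x -[k.+1%:R]natr1; field; exact: lt0r_neq0.
  have -> : C * ((b - a) / n.+1%:R) ^+ 2 = C * (b - a) ^+ 2 / n.+1%:R ^+ 2.
    by field; exact: lt0r_neq0.
  set Q := C * _ / _; rewrite -[k.+1%:R]natr1 mulrDl mul1r; lra.
have := step n.+1 (leqnn _).
have -> : x n.+1 = b by rewrite /x; field; exact: lt0r_neq0.
have -> : n.+1%:R * (C * (b - a) ^+ 2 / n.+1%:R ^+ 2) = C * (b - a) ^+ 2 / n.+1%:R.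
  by field; exact: lt0r_neq0.
by rewrite ler_pdivlMr// mulrC.
Qed.

(* Let theta be the least weight on S. If theta < N/s, each w i with i in S
   dominates l (N/s) + (1-l) (N alpha i), where l = theta s / N and alpha is a
   probability vector on S. *)
Lemma sum_powR_largest (s N : nat) (w : 'I_s -> R) (S : {set 'I_s}) (q : R) :
  (0 < N)%N -> (N <= s)%N -> 0 < q <= 1 -> N%:R <= s%:R `^ q ->
  (forall i, 0 <= w i) -> \sum_i w i = N%:R -> largest_coords N w S ->
  N%:R * (N%:R / s%:R) `^ q <= \sum_(i in S) w i `^ q.
Proof.
move=> N0 Ns hq hNs w0 sw [cS hS]; have /andP[q0 q1] := hq.
have s0 : (0 < s)%N by apply: leq_trans Ns.
have sR : 0 < s%:R :> R by rewrite ltr0n.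
have NR : 0 < N%:R :> R by rewrite ltr0n.
have [i0 i0S] : exists i, i \in S by apply/card_gt0P; rewrite cS.
pose i1 := [arg min_(i < i0 in S) w i]%O.
have [i1S i1min] : i1 \in S /\ forall i, i \in S -> w i1 <= w i.
  by rewrite /i1; case: arg_minP.
set th := w i1 in i1min.
have th_out j : j \notin S -> w j <= th by exact: hS.
have cSsum (c : R) : \sum_(i in S) c = N%:R * c by rewrite sumr_const cS mulr_natl.
(* If the least weight on S reaches the average N/s, the bound holds term by term. *)
have [thge|thlt] := leP (N%:R / s%:R) th.
  rewrite -cSsum; apply: ler_sum => i iS.
  by rewrite ge0_ler_powR ?nnegrE ?divr_ge0 ?(ltW q0)//; apply: le_trans thge (i1min _ iS).
have th0 : 0 <= th by exact: w0.
set l := th * s%:R / N%:R.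
have l0 : 0 <= l by rewrite divr_ge0 ?mulr_ge0.
have l1 : l < 1 by rewrite ltr_pdivrMr// mul1r -ltr_pdivlMr.
have thE : th = l * (N%:R / s%:R) by rewrite /l; field; rewrite !lt0r_neq0.
pose Y := \sum_(i in S) (w i - th).
(* Coordinates outside S are at most [th], so the excess over [th] carried by S is at least N - s th
   = (1 - l) N. *)
have YD : (1 - l) * N%:R <= Y.
  have : \sum_(i in ~: S) w i <= (s%:R - N%:R) * th.
    have -> : (s%:R - N%:R) * th = \sum_(i in ~: S) th.
      rewrite sumr_const -[RHS]mulr_natl; congr (_ * _).
      have -> : s%:R = N%:R + #|~: S|%:R :> R by rewrite -natrD -cS cardsC card_ord.
      by rewrite addrC addKr.
    by apply: ler_sum => i; rewrite inE => /th_out.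
  have : \sum_i w i = \sum_(i in S) w i + \sum_(i in ~: S) w i.
    rewrite (bigID (mem S))/=; congr (_ + _); apply: eq_bigl => i; by rewrite inE.
  rewrite sw /Y sumrB cSsum.
  have -> : (1 - l) * N%:R = N%:R - s%:R * th by rewrite /l; field; rewrite lt0r_neq0.
  lra.
have Y0 : 0 < Y by apply: lt_le_trans YD; rewrite mulr_gt0 ?subr_gt0.
pose al i := (w i - th) / Y.
have al0 i : i \in S -> 0 <= al i by move=> iS; rewrite divr_ge0 ?subr_ge0 ?i1min ?ltW.
have sal : \sum_(i in S) al i = 1 by rewrite -mulr_suml divff ?lt0r_neq0.
have al1 i : i \in S -> al i <= 1.
  move=> iS; rewrite -sal (bigD1 i)//= lerDl sumr_ge0// => j /andP[jS _]; exact: al0.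
have lb i : i \in S ->
    l * (N%:R / s%:R) `^ q + (1 - l) * (N%:R `^ q * al i) <= w i `^ q.
  move=> iS; apply: (@le_trans _ _ ((l * (N%:R / s%:R) + (1 - l) * (N%:R * al i)) `^ q)).
    have hl : 0 <= l <= 1 by rewrite l0 ltW.
    have hNa : 0 <= N%:R * al i by rewrite mulr_ge0 ?al0.
    have hNs0 : 0 <= N%:R / s%:R :> R by rewrite divr_ge0.
    apply: le_trans (powR_concave hq hNs0 hNa hl).
    rewrite lerD2l ler_wpM2l ?subr_ge0 ?(ltW l1)// powRM ?al0// ler_wpM2l ?powR_ge0//.
    have := al0 _ iS; rewrite le_eqVlt => /orP[/eqP <-|a0]; first by rewrite powR_ge0.
    by apply: ger1_powR; rewrite // a0 al1.
  apply: ge0_ler_powR; rewrite ?nnegrE ?(ltW q0)//.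
    apply: addr_ge0; apply: mulr_ge0; rewrite ?subr_ge0 ?(ltW l1)//.
    by rewrite mulr_ge0 ?al0 ?ler0n.
  rewrite -thE mulrA -lerBrDl.
  have -> : w i - th = Y * al i by rewrite /al mulrC divfK ?lt0r_neq0.
  by rewrite ler_wpM2r ?al0.
apply: (@le_trans _ _ (\sum_(i in S)
  (l * (N%:R / s%:R) `^ q + (1 - l) * (N%:R `^ q * al i)))); last exact: ler_sum.
rewrite big_split/= cSsum -!mulr_sumr sal mulr1.
(* Here N <= s^q enters: the uniform value does not exceed the one-point value N^q. *)
have : N%:R * (N%:R / s%:R) `^ q <= N%:R `^ q :> R.
  rewrite powRM ?invr_ge0 ?ler0n// mulrCA ler_piMr ?powR_ge0//.
  by rewrite -powR_inv1 ?ler0n// powRAC powR_inv1 ?powR_ge0// ler_pdivrMr ?powR_gt0// mul1r.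
set X := (N%:R / s%:R) `^ q => hX.
have h1 : 0 <= 1 - l by rewrite subr_ge0 ltW.
have := ler_wpM2l h1 hX; lra.
Qed.

End Scalars.

(** * Real symmetric matrices and functional calculus *)

Section RealSpectral.
Variable R : realType.

Definition dot n (x y : 'cV[R]_n) : R := (x^T *m y) 0 0.

Lemma dotE n (x y : 'cV[R]_n) : dot x y = \sum_i x i 0 * y i 0.
Proof. by rewrite /dot mxE; apply: eq_bigr => i _; rewrite mxE. Qed.

Lemma dotC n (x y : 'cV[R]_n) : dot x y = dot y x.
Proof. by rewrite !dotE; apply: eq_bigr => i _; rewrite mulrC. Qed.

Lemma dotDl n (x y z : 'cV[R]_n) : dot (x + y) z = dot x z + dot y z.
Proof. by rewrite /dot linearD mulmxDl mxE. Qed.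

Lemma dotZl n a (x z : 'cV[R]_n) : dot (a *: x) z = a * dot x z.
Proof. by rewrite /dot linearZ -scalemxAl mxE. Qed.

Lemma dotDr n (x y z : 'cV[R]_n) : dot z (x + y) = dot z x + dot z y.
Proof. by rewrite dotC dotDl !(dotC z). Qed.

Lemma dotZr n a (x z : 'cV[R]_n) : dot z (a *: x) = a * dot z x.
Proof. by rewrite dotC dotZl dotC. Qed.

Lemma dotBr n (x y z : 'cV[R]_n) : dot z (x - y) = dot z x - dot z y.
Proof. by rewrite -scaleN1r dotDr dotZr mulN1r. Qed.

Lemma dotBl n (x y z : 'cV[R]_n) : dot (x - y) z = dot x z - dot y z.
Proof. by rewrite dotC dotBr !(dotC z). Qed.

Lemma dot_mulmxl n k (A : 'M[R]_(k, n)) x y : dot (A *m x) y = dot x (A^T *m y).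
Proof. by rewrite /dot trmx_mul mulmxA. Qed.

Lemma dotxx_ge0 n (x : 'cV[R]_n) : 0 <= dot x x.
Proof. by rewrite dotE sumr_ge0// => i _; rewrite -expr2 sqr_ge0. Qed.

Lemma dotxx_gt0 n (x : 'cV[R]_n) : x != 0 -> 0 < dot x x.
Proof.
move=> x0; rewrite lt_neqAle dotxx_ge0 andbT eq_sym; apply: contra x0.
rewrite dotE psumr_eq0 => [|i _]; last by rewrite -expr2 sqr_ge0.
move=> /allP h; apply/eqP/colP => i; rewrite mxE.
by have := h i (mem_index_enum _); rewrite -expr2 sqrf_eq0 => /eqP.
Qed.

(** A complex eigenvector x + iy for a + ib satisfies A x = a x - b y and A y = b x + a y. Symmetry
    of A gives b (|x|^2 + |y|^2) = 0, so b = 0 and whichever of x, y is nonzero is a real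
    eigenvector. *)
Lemma sym_eigenvector n (A : 'M[R]_n) : (0 < n)%N -> A^T = A ->
  exists a (v : 'cV[R]_n), v != 0 /\ A *m v = a *: v.
Proof.
move=> n0 symA.
pose toC := @complex.real_complex_def R (Phant R).
pose AC := map_mx toC A.
have [z rz] : exists z, root (char_poly AC) z.
  by apply/closed_rootP; rewrite size_char_poly eqSS -lt0n.
have /eigenvalueP[v vA v0] : eigenvalue AC z by rewrite eigenvalue_root_char.
pose x : 'cV[R]_n := \col_i complex.Re (v 0 i).
pose y : 'cV[R]_n := \col_i complex.Im (v 0 i).
case: z rz vA => a b rz vA.
have E i : \sum_j v 0 j * AC j i = complex.Complex a b * v 0 i.
  by have := congr1 (fun w : 'rV_n => w 0 i) vA; rewrite !mxE.
have Aij i j : A i j = A j i by rewrite -{1}symA mxE.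
have ReS (F : 'I_n -> complex.complex R) : complex.Re (\sum_j F j) = \sum_j complex.Re (F j).
  by apply: (big_morph (@complex.Re R)) => // -[? ?] [? ?].
have ImS (F : 'I_n -> complex.complex R) : complex.Im (\sum_j F j) = \sum_j complex.Im (F j).
  by apply: (big_morph (@complex.Im R)) => // -[? ?] [? ?].
have Ax : A *m x = a *: x - b *: y.
  apply/colP => i; have := congr1 (@complex.Re R) (E i); rewrite ReS !mxE => h.
  transitivity (complex.Re (complex.Complex a b * v 0 i)); last by case: (v 0 i).
  rewrite -h; apply: eq_bigr => j _; rewrite !mxE Aij.
  by case: (v 0 j) => c d /=; rewrite mulr0 subr0 mulrC.
have Ay : A *m y = b *: x + a *: y.
  apply/colP => i; have := congr1 (@complex.Im R) (E i); rewrite ImS !mxE => h.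
  transitivity (complex.Im (complex.Complex a b * v 0 i)); last first.
    by case: (v 0 i) => c d /=; rewrite addrC.
  rewrite -h; apply: eq_bigr => j _; rewrite !mxE Aij.
  by case: (v 0 j) => c d /=; rewrite mulr0 add0r mulrC.
have xy0 : x != 0 \/ y != 0.
  have [x0|] := eqVneq x 0; last by left.
  right; apply: contra v0 => /eqP y0; apply/eqP/rowP => i; rewrite mxE.
  have := congr1 (fun w : 'cV_n => w i 0) x0; rewrite !mxE.
  have := congr1 (fun w : 'cV_n => w i 0) y0; rewrite !mxE.
  by case: (v 0 i) => c d /= -> ->.
have b0 : b = 0.
  have : dot (A *m x) y = dot x (A *m y) by rewrite dot_mulmxl symA.
  rewrite Ax Ay dotBl dotDr !dotZl !dotZr => h.
  have : b * (dot x x + dot y y) = 0 by lra.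
  move/eqP; rewrite mulf_eq0 => /orP[/eqP//|/eqP h2]; exfalso.
  have := dotxx_ge0 x; have := dotxx_ge0 y.
  by case: xy0 => /dotxx_gt0; lra.
move: Ax Ay; rewrite b0 !scale0r subr0 add0r => Ax Ay.
by case: xy0 => h; [exists a, x|exists a, y].
Qed.

(** Householder reflection along [v - e]; the identity serves when [v] already is the basis
    vector. *)
Lemma reflection_to_delta n (v : 'cV[R]_n.+1) : dot v v = 1 ->
  exists H : 'M[R]_n.+1, [/\ H^T = H, H *m H = 1%:M & H *m v = delta_mx 0 0].
Proof.
move=> v1; set e : 'cV[R]_n.+1 := delta_mx 0 0; pose u := v - e.
have e1 : dot e e = 1.
  rewrite dotE (bigD1 0)//= big1 ?addr0; last first.
    by move=> i /negPf i0; rewrite !mxE i0 mul0r.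
  by rewrite !mxE mulr1.
have [u0|u0] := eqVneq u 0.
  exists 1%:M; rewrite trmx1 mulmx1 mul1mx; split => //.
  by apply/eqP; rewrite -subr_eq0; apply/eqP.
have uu := dotxx_gt0 u0; set c := dot u u in uu.
have uuT (w : 'cV[R]_n.+1) : u *m u^T *m w = dot u w *: u.
  by rewrite -mulmxA [u^T *m w]mx11_scalar mul_mx_scalar.
pose H := 1%:M - (2 / c) *: (u *m u^T); exists H.
have Hw w : H *m w = w - (2 / c * dot u w) *: u.
  by rewrite /H mulmxBl mul1mx -scalemxAl uuT scalerA.
split.
- by rewrite /H linearB linearZ /= trmx1 trmx_mul trmxK.
- rewrite {2}/H mulmxBr mulmx1 -scalemxAr mulmxA Hw -/c divfK ?gt_eqF//.
  have -> : u - 2 *: u = - u by rewrite scaler_nat mulr2n opprD addNKr.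
  by rewrite mulNmx scalerN opprK /H subrK.
- have cE : c = 2 * dot u v.
    by rewrite /c /u !(dotBl, dotBr) v1 e1 (dotC e v); ring.
  rewrite Hw cE; have -> : 2 / (2 * dot u v) * dot u v = 1.
    by field; apply: lt0r_neq0; move: uu; rewrite cE; lra.
  by rewrite scale1r /u opprB addrC subrK.
Qed.


(** Conjugating by the reflection that sends a unit eigenvector to the first basis vector splits off
    a 1 x 1 block; the induction hypothesis diagonalizes the other one. *)
Lemma spectral_theorem n (A : 'M[R]_n) : A^T = A ->
  exists (Q : 'M[R]_n) (d : 'rV[R]_n),
    Q^T *m Q = 1%:M /\ A = Q^T *m diag_mx d *m Q.
Proof.
elim: n A => [|n IH] A symA.
  by exists 1%:M, 0; split; apply/matrixP => -[].
have [a [w [w0 Aw]]] := sym_eigenvector (ltn0Sn n) symA.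
pose v := (Num.sqrt (dot w w))^-1 *: w.
have Av : A *m v = a *: v by rewrite /v -scalemxAr Aw !scalerA mulrC.
have v1 : dot v v = 1.
  rewrite /v dotZl dotZr mulrA -invfM -expr2 sqr_sqrtr ?dotxx_ge0// mulVf//.
  by rewrite gt_eqF// dotxx_gt0.
have [H [HT HH Hv]] := reflection_to_delta v1.
have [B [symB Be AE]] : exists B : 'M[R]_(1 + n), [/\ B^T = B,
    B *m delta_mx 0 0 = a *: (delta_mx 0 0 : 'cV_(1 + n)) & A = H *m B *m H].
  exists (H *m A *m H); split; first by rewrite !trmx_mul HT symA mulmxA.
    by rewrite -!mulmxA -{1}Hv (mulmxA H H) HH mul1mx Av -scalemxAr Hv.
  by rewrite !mulmxA HH mul1mx -mulmxA HH mulmx1.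
have lsh : lshift n 0 = 0 :> 'I_(1 + n) by apply/val_inj.
have B0 i : B i 0 = a * (i == 0)%:R.
  have := congr1 (fun x : 'cV_(1 + n) => x i 0) Be.
  rewrite -colE !mxE => ->; by rewrite andbT.
have BE : B = block_mx (a%:M) 0 0 (drsubmx B).
  rewrite -[LHS]submxK; congr block_mx.
  - by apply/matrixP => i j; rewrite !mxE !ord1 lsh B0 eqxx mulr1 mulr1n.
  - by apply/matrixP => i j; rewrite !mxE ord1 lsh -symB mxE B0 mulr0.
  - by apply/matrixP => i j; rewrite !mxE ord1 lsh B0 mulr0.
have symD : (drsubmx B)^T = drsubmx B by rewrite trmx_drsub symB.
have [Q [d [QQ dE]]] := IH _ symD.
pose P : 'M[R]_(1 + n) := block_mx 1%:M 0 0 Q.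
exists (P *m H), (row_mx (a%:M) d : 'rV_(1 + n)).
have PT : P^T = block_mx 1%:M 0 0 Q^T by rewrite /P tr_block_mx trmx1 !trmx0.
split.
  rewrite trmx_mul mulmxA -(mulmxA _ P^T) PT mulmx_block !mulmx0 !mul0mx !mulmx1 !addr0 add0r QQ.
  by rewrite -scalar_mx_block mulmx1 HT HH.
have key : block_mx a%:M 0 0 (drsubmx B) =
    P^T *m diag_mx (row_mx a%:M d : 'rV_(1 + n)) *m P :> 'M[R]_(1 + n).
  rewrite PT /P diag_mx_row.
  rewrite !mulmx_block !(mulmx0, mul0mx, mulmx1, mul1mx, addr0, add0r) -dE.
  by congr block_mx; apply/matrixP => i j; rewrite !mxE !ord1.
by rewrite AE BE key trmx_mul HT !mulmxA.
Qed.

End RealSpectral.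

Definition spectral (R : realType) n (Q : 'M[R]_n) (d : 'rV[R]_n) (A : 'M[R]_n) : Prop :=
  Q^T *m Q = 1%:M /\ A = Q^T *m diag_mx d *m Q.

(** A diagonalization is picked by choice; [mxfunE] shows that the result does not depend on it. A
    non-symmetric matrix has none and gets the default value, the scalar matrix of [f 0]. *)
HB.lock Definition mxfun (R : realType) (f : R -> R) n (A : 'M[R]_n) : 'M[R]_n :=
  let Qd := xget (1%:M, 0) [set Qd : 'M[R]_n * 'rV[R]_n | spectral Qd.1 Qd.2 A]%classic in
  Qd.1^T *m diag_mx (map_mx f Qd.2) *m Qd.1.

Section FunctionalCalculus.
Variable R : realType.

(** The matrix U = P Q^T intertwines the two diagonals, so a nonzero entry U i j forces the
    eigenvalues e_i and d_j to agree. Hence U intertwines their images under f as well. *)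
Lemma mxfunE (f : R -> R) n (Q : 'M[R]_n) d A : spectral Q d A ->
  mxfun f A = Q^T *m diag_mx (map_mx f d) *m Q.
Proof.
move=> sA; rewrite unlock; case: xgetP => [[P e]/= _ [PP AE]|/(_ (Q, d))//].
case: sA => [QQ AE'].
have PP' := mulmx1C PP; have QQ' := mulmx1C QQ.
pose U := P *m Q^T.
have UD : diag_mx e *m U = U *m diag_mx d.
  rewrite /U mulmxA; transitivity (P *m A *m Q^T).
    by rewrite AE !mulmxA PP' mul1mx.
  by rewrite AE' !mulmxA -[_ *m Q *m _]mulmxA QQ' mulmx1.
have fUD : diag_mx (map_mx f e) *m U = U *m diag_mx (map_mx f d).
  apply/matrixP => i j; rewrite !mul_diag_mx !mul_mx_diag !mxE.
  have := congr1 (fun M : 'M[R]_n => M i j) UD.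
  rewrite !mul_diag_mx !mul_mx_diag !mxE; set u := (\sum__ _).
  have [->|u0] := eqVneq u 0; first by rewrite !mulr0 !mul0r.
  by rewrite mulrC => /(mulfI u0) ->; rewrite mulrC.
have := congr1 (fun M => P^T *m M *m Q) fUD.
rewrite /U !mulmxA -(mulmxA _ Q^T) QQ mulmx1 => ->.
by rewrite PP mul1mx.
Qed.

Lemma spectral_sym n (Q : 'M[R]_n) d A : spectral Q d A -> A^T = A.
Proof. by move=> [_ ->]; rewrite !trmx_mul trmxK tr_diag_mx mulmxA. Qed.

Lemma spectral_mxfun f n (Q : 'M[R]_n) d A : spectral Q d A ->
  spectral Q (map_mx f d) (mxfun f A).
Proof. by move=> sA; split; [case: sA|exact: mxfunE]. Qed.

Lemma mxfunM f g n (A : 'M[R]_n) : A^T = A ->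
  mxfun f A *m mxfun g A = mxfun (fun x => f x * g x) A.
Proof.
move=> /spectral_theorem[Q [d sA]].
rewrite !(mxfunE _ sA); case: sA => /mulmx1C QQ _.
rewrite !mulmxA -(mulmxA _ Q) QQ mulmx1 -[_ *m diag_mx _ *m diag_mx _]mulmxA mulmx_diag.
by congr (_ *m diag_mx _ *m _); apply/rowP => i; rewrite !mxE.
Qed.

Lemma mxfun_sym f n (A : 'M[R]_n) : A^T = A -> (mxfun f A)^T = mxfun f A.
Proof. by move=> /spectral_theorem[Q [d /(spectral_mxfun f)/spectral_sym]]. Qed.

Lemma mxfun_id n (A : 'M[R]_n) : A^T = A -> mxfun id A = A.
Proof.
move=> /spectral_theorem[Q [d sA]]; rewrite (mxfunE _ sA) map_mx_id//.
by case: sA.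
Qed.

Lemma mxfun_const c n (A : 'M[R]_n) : A^T = A -> mxfun (fun=> c) A = c%:M.
Proof.
move=> /spectral_theorem[Q [d sA]]; rewrite (mxfunE _ sA).
have -> : diag_mx (map_mx (fun=> c) d) = c%:M.
  by apply/matrixP => i j; rewrite !mxE.
by case: sA => QQ _; rewrite mul_mx_scalar -scalemxAl QQ scalemx1.
Qed.

Lemma mxfunZ f c n (A : 'M[R]_n) : A^T = A ->
  mxfun f (c *: A) = mxfun (fun x => f (c * x)) A.
Proof.
move=> /spectral_theorem[Q [d [QQ AE]]].
rewrite (@mxfunE _ _ Q d A)// (@mxfunE _ _ Q (c *: d) (c *: A))//; last first.
  by split=> //; rewrite AE linearZ/= -scalemxAr -scalemxAl.
by congr (_ *m diag_mx _ *m _); apply/rowP => i; rewrite !mxE.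
Qed.

Lemma spectral_dot n (Q : 'M[R]_n) d A x : spectral Q d A ->
  dot x (A *m x) = \sum_i d 0 i * (Q *m x) i 0 ^+ 2.
Proof.
move=> [_ ->]; rewrite -!mulmxA -{2}[Q]trmxK -dot_mulmxl trmxK.
rewrite dotE; apply: eq_bigr => i _; rewrite mul_diag_mx [X in _ * X]mxE.
by rewrite expr2 mulrCA.
Qed.

Lemma psdP n (A : 'M[R]_n) : psd A <-> A^T = A /\ forall x, 0 <= dot x (A *m x).
Proof. by rewrite /psd /dot; split=> -[sA h]; split=> // x; have := h x; rewrite mulmxA. Qed.

Lemma spectral_psd n (Q : 'M[R]_n) d A : spectral Q d A ->
  psd A <-> forall i, 0 <= d 0 i.
Proof.
move=> sA; rewrite psdP; split=> [[_ h] i|h].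
  have [QQ _] := sA; have := h (Q^T *m delta_mx i 0).
  rewrite (spectral_dot _ sA) mulmxA (mulmx1C QQ) mul1mx.
  rewrite (bigD1 i)//= big1 ?addr0 => [|j /negPf ji]; last first.
    by rewrite !mxE ji expr0n mulr0.
  by rewrite !mxE !eqxx expr1n mulr1.
split=> [|x]; first exact: spectral_sym sA.
by rewrite (spectral_dot _ sA) sumr_ge0// => i _; rewrite mulr_ge0 ?sqr_ge0.
Qed.

Lemma mxfun_psd f n (A : 'M[R]_n) : psd A -> (forall x, 0 <= x -> 0 <= f x) ->
  psd (mxfun f A).
Proof.
move=> pA f0; have [Q [d sA]] := spectral_theorem (proj1 pA).
apply/(spectral_psd (spectral_mxfun f sA)) => i; rewrite mxE f0//.
by have /(spectral_psd sA) := pA; apply.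
Qed.

Lemma eq_mxfun_psd f g n (A : 'M[R]_n) : psd A ->
  (forall x, 0 <= x -> f x = g x) -> mxfun f A = mxfun g A.
Proof.
move=> pA fg; have [Q [d sA]] := spectral_theorem (proj1 pA).
rewrite !(mxfunE _ sA); congr (_ *m diag_mx _ *m _); apply/rowP => i.
by rewrite !mxE fg//; have /(spectral_psd sA) := pA; apply.
Qed.

Lemma psdD n (A B : 'M[R]_n) : psd A -> psd B -> psd (A + B).
Proof.
move=> /psdP[sA hA] /psdP[sB hB]; apply/psdP; split=> [|x].
  by rewrite linearD/= sA sB.
by rewrite mulmxDl dotDr addr_ge0.
Qed.

Lemma psdZ n c (A : 'M[R]_n) : 0 <= c -> psd A -> psd (c *: A).
Proof.
move=> c0 /psdP[sA hA]; apply/psdP; split=> [|x]; first by rewrite linearZ/= sA.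
by rewrite -scalemxAl dotZr mulr_ge0.
Qed.

Lemma psd0 n : psd (0 : 'M[R]_n).
Proof. by apply/psdP; split=> [|x]; rewrite ?trmx0// mul0mx /dot mulmx0 mxE. Qed.

Lemma psd_sum n (I : Type) (r : seq I) (P : pred I) (F : I -> 'M[R]_n) :
  (forall i, P i -> psd (F i)) -> psd (\sum_(i <- r | P i) F i).
Proof. by move=> h; elim/big_ind: _ => //; [exact: psd0|exact: psdD]. Qed.

Lemma psd_scalar n c : 0 <= c -> psd (c%:M : 'M[R]_n).
Proof.
move=> c0; apply/psdP; split=> [|x]; first by rewrite tr_scalar_mx.
by rewrite mul_scalar_mx dotZr mulr_ge0// dotxx_ge0.
Qed.

Lemma psd_conj n k (A : 'M[R]_n) (C : 'M[R]_(n, k)) : psd A -> psd (C^T *m A *m C).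
Proof.
move=> /psdP[sA hA]; apply/psdP; split=> [|x].
  by rewrite !trmx_mul trmxK sA mulmxA.
by rewrite -!mulmxA -{1}[C]trmxK -dot_mulmxl trmxK.
Qed.

Lemma trmxfun_sum f n (Q : 'M[R]_n) d A : spectral Q d A ->
  \tr (mxfun f A) = \sum_i f (d 0 i).
Proof.
move=> sA; rewrite (mxfunE _ sA); case: sA => /mulmx1C QQ _.
rewrite -mulmxA mxtrace_mulC -mulmxA QQ mulmx1 mxtrace_diag.
by apply: eq_bigr => i _; rewrite mxE.
Qed.

Lemma psd_trace_ge0 n (A : 'M[R]_n) : psd A -> 0 <= \tr A.
Proof.
move=> pA; have [Q [d sA]] := spectral_theorem (proj1 pA).
rewrite -[A]mxfun_id ?(trmxfun_sum _ sA) ?(proj1 pA)// sumr_ge0// => i _.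
by have /(spectral_psd sA) := pA; apply.
Qed.

Lemma psd_mxfun_sqrt n (A : 'M[R]_n) : psd A -> exists C : 'M[R]_n, C^T = C /\ A = C *m C.
Proof.
move=> pA; have sA := proj1 pA; exists (mxfun Num.sqrt A); split; first exact: mxfun_sym.
rewrite mxfunM// -{1}[A]mxfun_id//; apply: eq_mxfun_psd => // x x0.
by rewrite -expr2 sqr_sqrtr.
Qed.

(** The product need not be symmetric, but with A = C C its trace is that of the positive matrix C B
    C. *)
Lemma psd_trace_mul_ge0 n (A B : 'M[R]_n) : psd A -> psd B -> 0 <= \tr (A *m B).
Proof.
move=> /psd_mxfun_sqrt[C [CT ->]] pB.
by rewrite -mulmxA mxtrace_mulC -{1}CT; apply/psd_trace_ge0/psd_conj.
Qed.

Lemma trace_mul_le n (A B C : 'M[R]_n) : psd C -> psd (B - A) ->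
  \tr (A *m C) <= \tr (B *m C).
Proof.
by move=> pC pAB; rewrite -subr_ge0 -raddfB -mulmxBl psd_trace_mul_ge0.
Qed.

(** * Klein's inequality for traces of two non-commuting matrices *)

Lemma trace_mxfun_mul f g n (P Q : 'M[R]_n) d e A B :
  spectral P d A -> spectral Q e B ->
  \tr (mxfun f A *m mxfun g B) =
  \sum_i \sum_j (P *m Q^T) i j ^+ 2 * (f (d 0 i) * g (e 0 j)).
Proof.
move=> sA sB; rewrite (mxfunE _ sA) (mxfunE _ sB).
rewrite -!mulmxA mxtrace_mulC; set U := P *m Q^T.
have -> : diag_mx (map_mx f d) *m (P *m (Q^T *m (diag_mx (map_mx g e) *m Q))) *m P^T
        = diag_mx (map_mx f d) *m (U *m diag_mx (map_mx g e) *m U^T).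
  by rewrite /U trmx_mul trmxK !mulmxA.
clearbody U; rewrite /mxtrace; apply: eq_bigr => i _.
rewrite mul_diag_mx !mxE big_distrr/=.
by apply: eq_bigr => j _; rewrite mul_mx_diag !mxE; ring.
Qed.

Lemma sum_sqr_row_orthogonal n (U : 'M[R]_n) i : U *m U^T = 1%:M -> \sum_j U i j ^+ 2 = 1.
Proof.
move=> /(congr1 (fun M : 'M[R]_n => M i i)); rewrite !mxE eqxx mulr1n => <-.
by apply: eq_bigr => j _; rewrite mxE.
Qed.

Lemma orthogonal_sum_sqr n (U : 'M[R]_n) : U *m U^T = 1%:M ->
  (forall i, \sum_j U i j ^+ 2 = 1) /\ (forall j, \sum_i U i j ^+ 2 = 1).
Proof.
move=> UU; split=> [i|j]; first exact: sum_sqr_row_orthogonal.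
have UU' : U^T *m U^T^T = 1%:M by rewrite trmxK; apply: mulmx1C.
transitivity (\sum_i U^T j i ^+ 2); last exact: sum_sqr_row_orthogonal UU'.
by apply: eq_bigr => i _; rewrite mxE.
Qed.

(** The squared entries of U = P Q^T form a doubly stochastic matrix, so every trace becomes a
    double sum with the same weights and the inequality reduces to the scalar tangent inequality
    term by term. Separate domains [D] and [E] let the tangency point be definite while the other
    matrix is singular. *)
Lemma trace_klein (D E : pred R) (f f' : R -> R) n (P Q : 'M[R]_n) d e A B :
  (forall x y, D x -> E y -> f y <= f x + f' x * (y - x)) ->
  spectral P d A -> spectral Q e B ->
  (forall i, D (d 0 i)) -> (forall i, E (e 0 i)) ->
  \tr (mxfun f B) <= \tr (mxfun f A) + \tr (mxfun f' A *m (B - A)).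
Proof.
move=> ff' sA sB Dd Ee.
have symA := spectral_sym sA; have symB := spectral_sym sB.
pose U := P *m Q^T.
have UU : U *m U^T = 1%:M.
  rewrite /U trmx_mul trmxK !mulmxA -[_ *m Q^T *m _]mulmxA.
  by rewrite (proj1 sB) mulmx1 mulmx1C// (proj1 sA).
have [Ur Uc] := orthogonal_sum_sqr UU.
have -> : \tr (mxfun f' A *m (B - A)) =
    \tr (mxfun f' A *m mxfun id B) - \tr (mxfun (fun x => f' x * x) A).
  by rewrite mulmxBr raddfB/= mxfun_id// -(@mxfunM f' id)// mxfun_id.
rewrite (trace_mxfun_mul _ _ sA sB) -/U !(trmxfun_sum _ sA) (trmxfun_sum _ sB).
have -> : \sum_i f (e 0 i) = \sum_i \sum_j U i j ^+ 2 * f (e 0 j).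
  by rewrite exchange_big; apply: eq_bigr => j _; rewrite -mulr_suml Uc mul1r.
have -> : \sum_i f (d 0 i) = \sum_i \sum_j U i j ^+ 2 * f (d 0 i).
  by apply: eq_bigr => i _; rewrite -mulr_suml Ur mul1r.
have -> : \sum_i f' (d 0 i) * d 0 i = \sum_i \sum_j U i j ^+ 2 * (f' (d 0 i) * d 0 i).
  by apply: eq_bigr => i _; rewrite -mulr_suml Ur mul1r.
rewrite -sumrB -big_split/=; apply: ler_sum => i _.
rewrite -sumrB -big_split/=; apply: ler_sum => j _.
rewrite -mulrBr -mulrDr ler_wpM2l ?sqr_ge0//.
by have := ff' _ _ (Dd i) (Ee j); rewrite mulrBr.
Qed.

(** * Eigenvalues as roots of the characteristic polynomial *)

Lemma char_poly_spectral n (Q : 'M[R]_n) d A : spectral Q d A ->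
  char_poly A = \prod_i ('X - (d 0 i)%:P).
Proof.
move=> [QQ ->]; pose QP := map_mx polyC Q.
have QPQP : QP^T *m QP = 1%:M by rewrite /QP map_trmx -map_mxM QQ map_mx1.
have -> : char_poly (Q^T *m diag_mx d *m Q) = char_poly (diag_mx d).
  rewrite /char_poly /char_poly_mx !map_mxM -map_trmx -/QP.
  have XE : 'X%:M = QP^T *m 'X%:M *m QP by rewrite mul_mx_scalar -scalemxAl QPQP scalemx1.
  by rewrite {1}XE -mulmxBl -mulmxBr !det_mulmx mulrAC -det_mulmx QPQP det1 mul1r.
rewrite char_poly_trig ?diag_mx_is_trig//.
by apply: eq_bigr => i _; rewrite mxE eqxx.
Qed.

Lemma count_flatten_nseq (T : eqType) (c : T -> nat) (r : seq T) x :
  count_mem x (flatten [seq nseq (c y) y | y <- r]) = (count_mem x r * c x)%N.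
Proof.
elim: r => //= y r IH; rewrite count_cat IH mulnDl count_nseq /=; congr (_ + _)%N.
by have [->|_] := eqVneq y x; rewrite ?mul0n.
Qed.

Lemma count_roots_mup (p : {poly R}) x : p != 0 ->
  count_mem x (flatten [seq nseq (mup y p) y | y <- rootsR p]) = mup x p.
Proof.
move=> p0; rewrite (count_flatten_nseq (fun y => mup y p)) count_uniq_mem ?uniq_roots//.
have := roots_on_rootsR p0 x; rewrite in_itv/= => <-.
by case: (boolP (root p x)) => [_|/mupNroot->]; rewrite ?mul1n ?muln0.
Qed.

Lemma eigenvalues_spectral n (Q : 'M[R]_n) d A : spectral Q d A ->
  perm_eq (eigenvalues A) [seq d 0 i | i <- enum 'I_n].
Proof.
move=> sA; apply/allP => x _ /=; apply/eqP.
rewrite count_roots_mup ?(monic_neq0 (char_poly_monic A))// (char_poly_spectral sA).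
by rewrite -mu_prod_XsubC big_map big_enum.
Qed.

(** The link between the eigenvalue list of the statement and the functional calculus: both run
    through the diagonal [d] with multiplicities. *)
Lemma sum_eigenvalues (f : R -> R) n (A : 'M[R]_n) : A^T = A ->
  \sum_(x <- eigenvalues A) f x = \tr (mxfun f A).
Proof.
move=> /spectral_theorem[Q [d sA]].
rewrite (perm_big _ (eigenvalues_spectral sA))/= big_map big_enum/=.
by rewrite (trmxfun_sum _ sA).
Qed.

End FunctionalCalculus.

(** * Matrix powers and the Loewner-Heinz inequality *)

(** Zero to the power zero being 1, the zeroth power is the identity even at singular matrices. Its
    trace therefore agrees with the rank, the case p = 0 of [trace_pow], for definite matrices
    only. *)
HB.lock Definition mxpow (R : realType) (a : R) n (A : 'M[R]_n) : 'M[R]_n :=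
  mxfun (fun x => x `^ a) A.

Section Loewner.
Import numFieldNormedType.Exports.
Variable R : realType.

Lemma mxpowE a n (A : 'M[R]_n) : mxpow a A = mxfun (fun x => x `^ a) A.
Proof. by rewrite unlock. Qed.

(** An explicit margin [b] bounds all eigenvalues from below at once, survives the addition of
    positive matrices, and gives the constants with which perturbations are dominated. *)
Definition posdef n (A : 'M[R]_n) : Prop := exists2 b, 0 < b & psd (A - b%:M).

Lemma posdef_psd n (A : 'M[R]_n) : posdef A -> psd A.
Proof. by case=> b b0 h; rewrite -[A](subrK b%:M); apply: psdD => //; apply/psd_scalar/ltW. Qed.

Lemma posdef_sym n (A : 'M[R]_n) : posdef A -> A^T = A.
Proof. by case/posdef_psd. Qed.
Hint Resolve posdef_sym posdef_psd : core.

Lemma posdefDr n (A B : 'M[R]_n) : posdef A -> psd B -> posdef (A + B).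
Proof. by case=> b b0 h pB; exists b => //; rewrite addrAC; apply: psdD. Qed.

Lemma posdef_le n (A B : 'M[R]_n) : posdef A -> psd (B - A) -> posdef B.
Proof. by move=> pA pAB; rewrite -[B](subrK A) addrC; apply: posdefDr. Qed.

Lemma posdefZ n c (A : 'M[R]_n) : 0 < c -> posdef A -> posdef (c *: A).
Proof.
move=> c0 [b b0 h]; exists (c * b); first exact: mulr_gt0.
by rewrite -scale_scalar_mx -scalerBr; apply: psdZ => //; apply: ltW.
Qed.

Lemma posdef_scalar n c : 0 < c -> posdef (c%:M : 'M[R]_n).
Proof. by move=> c0; exists c; rewrite // subrr; apply: psd0. Qed.

Lemma spectral_subscalar n (Q : 'M[R]_n) d A b : spectral Q d A ->
  spectral Q (d - const_mx b) (A - b%:M).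
Proof.
move=> [QQ ->]; split=> //.
by rewrite linearB/= diag_const_mx mulmxBr mulmxBl mul_mx_scalar -scalemxAl QQ scalemx1.
Qed.

Lemma spectral_ge n (Q : 'M[R]_n) d A b : spectral Q d A ->
  psd (A - b%:M) <-> forall i, b <= d 0 i.
Proof.
move=> sA; rewrite (spectral_psd (spectral_subscalar b sA)).
by split=> h i; have := h i; rewrite !mxE subr_ge0.
Qed.

Lemma spectral_le n (Q : 'M[R]_n) d A b : spectral Q d A ->
  psd (b%:M - A) <-> forall i, d 0 i <= b.
Proof.
move=> sA; have sA' : spectral Q (const_mx b - d) (b%:M - A).
  case: sA => QQ ->; split=> //.
  by rewrite linearB/= diag_const_mx mulmxBr mulmxBl mul_mx_scalar -scalemxAl QQ scalemx1.
rewrite (spectral_psd sA').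
by split=> h i; have := h i; rewrite !mxE subr_ge0.
Qed.

Lemma posdef_spectral n (Q : 'M[R]_n) d A i : spectral Q d A -> posdef A -> 0 < d 0 i.
Proof. by move=> sA [b b0] /(spectral_ge _ sA)/(_ i); apply: lt_le_trans. Qed.

Lemma eq_mxfun_posdef f g n (A : 'M[R]_n) : posdef A ->
  (forall x, 0 < x -> f x = g x) -> mxfun f A = mxfun g A.
Proof.
move=> pA fg; have [Q [d sA]] := spectral_theorem (posdef_sym pA).
rewrite !(mxfunE _ sA); congr (_ *m diag_mx _ *m _); apply/rowP => i.
by rewrite !mxE fg// (posdef_spectral _ sA).
Qed.

Lemma mxpowD n (A : 'M[R]_n) a b : posdef A -> mxpow a A *m mxpow b A = mxpow (a + b) A.
Proof.
move=> pA; rewrite !mxpowE mxfunM//; last exact: posdef_sym.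
by apply: eq_mxfun_posdef => // x x0; rewrite powRD// (gt_eqF x0) implybT.
Qed.

Lemma mxpow0 n (A : 'M[R]_n) : A^T = A -> mxpow 0 A = 1%:M.
Proof.
move=> sA; rewrite mxpowE (_ : (fun x => x `^ 0) = fun=> 1) ?mxfun_const//.
by apply/funext => x; rewrite powRr0.
Qed.

Lemma mxpow1 n (A : 'M[R]_n) : psd A -> mxpow 1 A = A.
Proof.
move=> pA; rewrite mxpowE -[RHS](mxfun_id (proj1 pA)); apply: eq_mxfun_psd => // x x0.
by rewrite powRr1.
Qed.

Lemma mxpow_psd n (A : 'M[R]_n) a : psd A -> psd (mxpow a A).
Proof. by move=> pA; rewrite mxpowE; apply: mxfun_psd => // x _; apply: powR_ge0. Qed.

Lemma mxpow_sym n (A : 'M[R]_n) a : A^T = A -> (mxpow a A)^T = mxpow a A.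
Proof. by rewrite mxpowE; apply: mxfun_sym. Qed.

Lemma mxpowZ n (A : 'M[R]_n) a c : 0 <= c -> psd A ->
  mxpow a (c *: A) = c `^ a *: mxpow a A.
Proof.
move=> c0 pA; have sA := proj1 pA; rewrite !mxpowE mxfunZ//.
have -> : c `^ a *: mxfun (fun x => x `^ a) A
        = mxfun (fun=> c `^ a) A *m mxfun (fun x => x `^ a) A.
  by rewrite mxfun_const// mul_scalar_mx.
by rewrite mxfunM//; apply: eq_mxfun_psd => // x x0; rewrite powRM.
Qed.

Lemma mxpowNK n (A : 'M[R]_n) a : posdef A -> mxpow a A *m mxpow (- a) A = 1%:M.
Proof. by move=> pA; rewrite mxpowD// subrr mxpow0//; apply: posdef_sym. Qed.

Lemma mxpowKN n (A : 'M[R]_n) a : posdef A -> mxpow (- a) A *m mxpow a A = 1%:M.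
Proof. by move=> pA; rewrite mxpowD// addNr mxpow0//; apply: posdef_sym. Qed.

Lemma psd_of_eigenvectors n (A : 'M[R]_n) : A^T = A ->
  (forall a (v : 'cV[R]_n), v != 0 -> A *m v = a *: v -> 0 <= a) -> psd A.
Proof.
move=> sA h; have [Q [d s]] := spectral_theorem sA.
apply/(spectral_psd s) => i; case: (s) => QQ AE.
have Qi : Q *m (Q^T *m delta_mx i 0) = delta_mx i 0 :> 'cV[R]_n.
  by rewrite mulmxA mulmx1C// mul1mx.
apply: (h _ (Q^T *m delta_mx i 0 : 'cV[R]_n)).
  apply/eqP => e; move: Qi; rewrite e mulmx0 => /(congr1 (fun M : 'cV[R]_n => M i 0)).
  by rewrite !mxE !eqxx => /eqP; rewrite eq_sym oner_eq0.
rewrite AE -!mulmxA Qi scalemxAr; congr (_ *m _).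
apply/colP => j; rewrite mul_diag_mx !mxE.
by case: eqVneq => [->|]; rewrite /= ?mulr0.
Qed.

(** * The Loewner-Heinz inequality *)

Definition pow_le n (X Y : 'M[R]_n) (q : R) := psd (mxpow q Y - mxpow q X).

(** Conjugated by Y^(-a), the hypothesis X^(2a) <= Y^(2a) reads Y^(-a) X^(2a) Y^(-a) <= 1, that is,
    X^a Y^(-a) does not increase norms. *)
Lemma pow_le_contraction n (X Y : 'M[R]_n) a u : posdef X -> posdef Y ->
  pow_le X Y (a + a) ->
  dot (mxpow a X *m (mxpow (- a) Y *m u)) (mxpow a X *m (mxpow (- a) Y *m u))
    <= dot u u.
Proof.
move=> pX pY hXY; have /psdP[_ h0] := hXY; have := h0 (mxpow (- a) Y *m u).
rewrite mulmxBl dotBr subr_ge0 => h.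
rewrite dot_mulmxl mxpow_sym ?posdef_sym// (mulmxA (mxpow a X)) mxpowD//.
apply: (le_trans h); rewrite mulmxA mxpowD// dot_mulmxl mxpow_sym ?posdef_sym//.
by rewrite mulmxA mxpowD// addrK addNr mxpow0 ?posdef_sym// mul1mx.
Qed.

(* With c = (b - a)/2, the matrix Y^(-(a+b)/2) X^(a+b) Y^(-(a+b)/2) is conjugate
   by Y^c to the product of the contractions (X^a Y^(-a))^T and X^b Y^(-b), so
   its eigenvalues are at most 1. *)
Lemma pow_le_mid n (X Y : 'M[R]_n) a b : posdef X -> posdef Y ->
  pow_le X Y (a + a) -> pow_le X Y (b + b) -> pow_le X Y (a + b).
Proof.
move=> pX pY ha hb; pose g := (a + b) / 2; pose c := (b - a) / 2.
have sX := posdef_sym pX; have sY := posdef_sym pY.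
pose T := mxpow (- g) Y *m mxpow (a + b) X *m mxpow (- g) Y.
have sT : T^T = T.
  by rewrite /T (trmx_mul (_ *m _)) (trmx_mul (mxpow _ _)) !mxpow_sym// mulmxA.
have pT : psd (1%:M - T).
  apply: psd_of_eigenvectors => [|l v v0 hv]; first by rewrite linearB/= trmx1 sT.
  have Tv : T *m v = (1 - l) *: v.
    by rewrite scalerBl scale1r -hv mulmxBl mul1mx opprB addrC subrK.
  pose u := mxpow c Y *m v.
  have u0 : u != 0.
    apply: contra v0 => /eqP u0.
    by rewrite -[v]mul1mx -(mxpowKN c pY) -mulmxA -/u u0 mulmx0.
  have Mu : mxpow (- a) Y *m (mxpow (a + b) X *m (mxpow (- b) Y *m u)) = (1 - l) *: u.
    have -> : - a = c + - g by rewrite /g /c; field.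
    rewrite /u (mulmxA _ _ v) mxpowD// -(mxpowD c)// -mulmxA.
    have -> : - b + c = - g by rewrite /g /c; field.
    by rewrite scalemxAr -Tv /T !mulmxA.
  have := pow_le_contraction u pX pY ha; have := pow_le_contraction u pX pY hb.
  set y := mxpow b X *m _; set x := mxpow a X *m _ => hy hx.
  have xy : dot x y = (1 - l) * dot u u.
    rewrite -dotZr -Mu /x /y dot_mulmxl mxpow_sym// dot_mulmxl mxpow_sym//.
    by rewrite (mulmxA (mxpow a X)) mxpowD.
  (* Expanding |x - y|^2 >= 0 and using both contraction bounds gives (1 - l) |u|^2 <= |u|^2, hence
     l >= 0. *)
  have := dotxx_ge0 (x - y); rewrite dotBl !dotBr (dotC y x) xy => h.
  have := dotxx_gt0 u0; rewrite -subr_ge0 => uu.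
  have : 0 <= l * dot u u by lra.
  by rewrite pmulr_lge0//; move: uu; rewrite subr_ge0.
rewrite /pow_le.
suff -> : mxpow (a + b) Y - mxpow (a + b) X = (mxpow g Y)^T *m (1%:M - T) *m mxpow g Y.
  exact: psd_conj.
rewrite mxpow_sym// mulmxBr mulmx1 mulmxBl mxpowD//.
rewrite /T !mulmxA mxpowNK// mul1mx -!mulmxA mxpowKN// mulmx1.
by rewrite (_ : g + g = a + b)//; rewrite /g; field.
Qed.

(** The exponents 0 and 1 are admissible and admissible exponents are closed under midpoints;
    k/2^(m+1) is the midpoint of i/2^m and j/2^m with i + j = k. *)
Lemma pow_le_dyadic n (X Y : 'M[R]_n) m k : posdef X -> posdef Y -> psd (Y - X) ->
  (k <= 2 ^ m)%N -> pow_le X Y (k%:R / 2 ^+ m).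
Proof.
move=> pX pY pXY; elim: m k => [|m IH] k.
  case: k => [|[|//]] _; rewrite /pow_le.
    by rewrite mul0r !mxpow0 ?posdef_sym// subrr; apply: psd0.
  by rewrite divr1 !mxpow1//; apply: posdef_psd.
rewrite expnS => hk; pose i := k./2; pose j := (k - i)%N.
have ki : k = (i + j)%N by rewrite /j /i; lia.
have hi : (i <= 2 ^ m)%N by rewrite /i; lia.
have hj : (j <= 2 ^ m)%N by rewrite /j /i; lia.
have hD (l : nat) : (l%:R / 2 ^+ m : R) = l%:R / 2 ^+ m.+1 + l%:R / 2 ^+ m.+1.
  by rewrite exprS; field; rewrite expf_neq0 ?pnatr_eq0.
rewrite ki natrD mulrDl; apply: pow_le_mid => //; rewrite -hD; exact: IH.
Qed.

Lemma continuous_ge0_dyadic (h : R -> R) (q : R) : 0 <= q <= 1 -> continuous h ->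
  (forall m k, (k <= 2 ^ m)%N -> 0 <= h (k%:R / 2 ^+ m)) -> 0 <= h q.
Proof.
move=> /andP[q0 q1] hc hd; rewrite leNgt; apply/negP => hq.
have [e /= e0 he] : exists2 e : R, 0 < e & forall y, `|q - y| < e -> h y < 0.
  have : \forall t \near nbhs q, h t < 0 by apply: (cvgr_lt (h q)); [exact: hc|exact: hq].
  by move=> /nbhs_ballP[e e0 he]; exists e.
pose m := Num.trunc e^-1; pose k := Num.trunc (q * 2 ^+ m.+1).
have pm : 0 < 2 ^+ m.+1 :> R by rewrite exprn_gt0.
have me : e^-1 < 2 ^+ m.+1.
  apply: (@lt_le_trans _ _ m.+1%:R); first exact: truncnS_gt.
  by rewrite -natrX ler_nat ltnW// ltn_expl.
have /andP[k1 k2] : k%:R <= q * 2 ^+ m.+1 < k.+1%:R.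
  by apply: truncn_itv; rewrite mulr_ge0// ltW.
have hk : (k <= 2 ^ m.+1)%N.
  rewrite -(ler_nat R) natrX; apply: (le_trans k1).
  by rewrite ler_piMl// ltW.
have := hd _ _ hk; rewrite leNgt => /negP; apply; apply: he.
rewrite ger0_norm; last by rewrite subr_ge0 ler_pdivrMr.
rewrite -[q](mulfK (lt0r_neq0 pm)) -mulrBl ltr_pdivrMr//.
move: me; rewrite -(ltr_pM2l e0) divff ?gt_eqF// => me.
apply: le_lt_trans me => //.
by rewrite lerBlDr ltW// addrC natr1.
Qed.

Lemma continuous_sum (I : Type) (r : seq I) (F : I -> R -> R) :
  (forall i, continuous (F i)) -> continuous (fun t => \sum_(i <- r) F i t).
Proof.
move=> Fc; elim: r => [|i r IH] t.
  by under eq_fun do rewrite big_nil; exact: cvg_cst.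
under eq_fun do rewrite big_cons.
by apply: cvgD; [exact: Fc|exact: IH].
Qed.

Lemma mxpow_dot_continuous n (X : 'M[R]_n) (x : 'cV[R]_n) : posdef X ->
  continuous (fun q => dot x (mxpow q X *m x)).
Proof.
move=> pX q; have [Q [d sX]] := spectral_theorem (posdef_sym pX).
have -> : (fun q => dot x (mxpow q X *m x)) =
    (fun q => \sum_i expR (q * ln (d 0 i)) * (Q *m x) i 0 ^+ 2).
  apply/funext => t; rewrite mxpowE (spectral_dot _ (spectral_mxfun _ sX)).
  by apply: eq_bigr => i _; rewrite mxE /powR gt_eqF// (posdef_spectral _ sX).
apply: continuous_sum => i t; apply: cvgM; last exact: cvg_cst.
apply: continuous_comp; last exact: continuous_expR.
by apply: cvgM; [exact: cvg_id|exact: cvg_cst].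
Qed.

(** Dyadic exponents are dense, and for definite matrices the quadratic forms are continuous in the
    exponent. *)
Lemma mxpow_le n (X Y : 'M[R]_n) q : posdef X -> psd (Y - X) -> 0 <= q <= 1 ->
  psd (mxpow q Y - mxpow q X).
Proof.
move=> pX pXY hq; have pY := posdef_le pX pXY.
apply/psdP; split=> [|x]; first by rewrite linearB/= !mxpow_sym ?posdef_sym.
rewrite mulmxBl dotBr.
apply: (@continuous_ge0_dyadic (fun q => dot x (mxpow q Y *m x) - dot x (mxpow q X *m x))) => //.
  by move=> t; apply: cvgB; apply: mxpow_dot_continuous.
move=> m k hk; have /psdP[_ /(_ x)] := pow_le_dyadic pX pY pXY hk.
by rewrite mulmxBl dotBr.
Qed.

(** With A = X^(-q) and B = Y^(-q), the identity A - B = (A - B) A^(-1) (A - B) + B (B^(-1) -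
    A^(-1)) B exhibits a sum of two positive matrices. *)
Lemma mxpowN_le n (X Y : 'M[R]_n) q : posdef X -> psd (Y - X) -> 0 <= q <= 1 ->
  psd (mxpow (- q) X - mxpow (- q) Y).
Proof.
move=> pX pXY hq; have pY := posdef_le pX pXY.
set A := mxpow (- q) X; set B := mxpow (- q) Y.
have sA : A^T = A by rewrite mxpow_sym// posdef_sym.
have sB : B^T = B by rewrite mxpow_sym// posdef_sym.
have -> : A - B = (A - B)^T *m mxpow q X *m (A - B)
                + B^T *m (mxpow q Y - mxpow q X) *m B.
  have AX : A *m mxpow q X = 1%:M by rewrite /A mxpowKN.
  have XA : mxpow q X *m A = 1%:M by rewrite /A mxpowNK.
  have BY : B *m mxpow q Y = 1%:M by rewrite /B mxpowKN.
  have sAB : (A - B)^T = A - B by rewrite linearB/= sA sB.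
  rewrite sAB sB !(mulmxBl, mulmxBr) AX !mul1mx BY mul1mx -(mulmxA B _ A) XA mulmx1.
  by apply/matrixP => i j; rewrite !mxE; ring.
by apply: psdD; apply: psd_conj; [apply/mxpow_psd/posdef_psd|exact: mxpow_le].
Qed.

Lemma trace_mxpowN_le n (X Y C : 'M[R]_n) q : posdef X -> psd (Y - X) -> psd C ->
  0 <= q <= 1 -> \tr (mxpow (- q) Y *m C) <= \tr (mxpow (- q) X *m C).
Proof. by move=> pX pXY pC hq; apply: trace_mul_le => //; apply: mxpowN_le. Qed.

End Loewner.

(** * Traces of powers along a chain of weights *)

Section TracePower.
Variable R : realType.
Implicit Types p t u b c : R.

Lemma powR_subadditive p x y : 0 < p <= 1 -> 0 <= x -> 0 <= y ->
  (x + y) `^ p <= x `^ p + y `^ p :> R.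
Proof.
move=> /andP[p0 p1] x0 y0; have : 0 <= x + y by rewrite addr_ge0.
rewrite le_eqVlt => /orP[/eqP <-|s0].
  by rewrite powR0 ?gt_eqF// addr_ge0 ?powR_ge0.
set s := x + y in s0 *.
have H z : 0 <= z -> z <= s -> s `^ p * (z / s) <= z `^ p.
  move=> z0 zs; rewrite -{2}[z](divfK (lt0r_neq0 s0)) powRM ?divr_ge0 ?(ltW s0)//.
  rewrite mulrC ler_wpM2r ?powR_ge0//.
  move: z0; rewrite le_eqVlt => /orP[/eqP <-|z0]; first by rewrite mul0r powR_ge0.
  by apply: ger1_powR => //; rewrite divr_gt0//= ler_pdivrMr// mul1r.
have := H x x0; have := H y y0; rewrite /s lerDl lerDr => /(_ x0) h1 /(_ y0) h2.
apply: le_trans (lerD h2 h1).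
by rewrite -mulrDr -mulrDl divff ?mulr1// gt_eqF.
Qed.

Lemma trace_mxpow_anti n (X Y C : 'M[R]_n) p : posdef X -> psd (Y - X) -> psd C ->
  0 <= p <= 1 -> \tr (mxpow (p - 1) Y *m C) <= \tr (mxpow (p - 1) X *m C).
Proof.
move=> pX pXY pC /andP[p0 p1]; rewrite -opprB; apply: trace_mxpowN_le => //.
by rewrite subr_ge0 p1 lerBlDr lerDl.
Qed.

(** The tangent inequality at [A] for the concave map tr X^p. Only the tangency point, where a
    negative power occurs, has to be definite. *)
Lemma trace_mxpow_klein n (A B : 'M[R]_n) p : 0 < p <= 1 -> posdef A -> psd B ->
  \tr (mxpow p B) <= \tr (mxpow p A) + p * \tr (mxpow (p - 1) A *m (B - A)).
Proof.
move=> hp pA pB.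
rewrite !mxpowE; have [P [d sA]] := spectral_theorem (posdef_sym pA).
have [Q [e sB]] := spectral_theorem (proj1 pB).
have -> : p * \tr (mxfun (fun x => x `^ (p - 1)) A *m (B - A)) =
    \tr (mxfun (fun x => p * x `^ (p - 1)) A *m (B - A)).
  rewrite -mxtraceZ scalemxAl; congr (\tr (_ *m _)).
  rewrite -mul_scalar_mx -(mxfun_const p (posdef_sym pA)) mxfunM//.
  exact: posdef_sym.
apply: (@trace_klein _ (fun x => 0 < x) (fun x => 0 <= x) _ _ _ P Q d e) => //.
- by move=> x y x0 y0; apply: powR_tangent.
- by move=> i; exact: (posdef_spectral i sA pA).
- by have /(spectral_psd sB) := pB.
Qed.

(** The tangent is taken at the larger matrix [B], which leaves [A] free to be singular. *)
Lemma trace_mxpow_mono n (A B : 'M[R]_n) p : 0 < p <= 1 -> psd A -> posdef B ->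
  psd (B - A) -> \tr (mxpow p A) <= \tr (mxpow p B).
Proof.
move=> hp pA pB pAB; apply: le_trans (trace_mxpow_klein hp pB pA) _.
rewrite gerDl pmulr_rle0; last by case/andP: hp.
by rewrite -oppr_ge0 -raddfN/= -mulmxN opprB psd_trace_mul_ge0//; apply/mxpow_psd/posdef_psd.
Qed.

Lemma trace_mxpow_shift n (A : 'M[R]_n) p b : 0 < p <= 1 -> psd A -> 0 <= b ->
  \tr (mxpow p (A + b%:M)) <= \tr (mxpow p A) + n%:R * b `^ p.
Proof.
move=> hp pA b0; have [Q [d sA]] := spectral_theorem (proj1 pA).
rewrite !mxpowE; have := spectral_subscalar (- b) sA; rewrite (_ : (- b)%:M = - b%:M); last first.
  by rewrite -scalemx1 scaleNr scalemx1.
rewrite opprK => sAb.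
rewrite (trmxfun_sum _ sA) (trmxfun_sum _ sAb).
have -> : n%:R * b `^ p = \sum_(i < n) b `^ p by rewrite sumr_const card_ord mulr_natl.
rewrite -big_split/=; apply: ler_sum => i _.
rewrite !mxE opprK powR_subadditive//.
by have /(spectral_psd sA) := pA.
Qed.

Lemma trace_mxpow_mul n (X : 'M[R]_n) p : posdef X ->
  \tr (mxpow (p - 1) X *m X) = \tr (mxpow p X).
Proof.
move=> pX; rewrite -{2}[X]mxpow1; last exact: posdef_psd.
by rewrite mxpowD// subrK.
Qed.

Lemma trace_mxpow_ge0 n (X C : 'M[R]_n) p : posdef X -> psd C ->
  0 <= \tr (mxpow p X *m C).
Proof. by move=> pX pC; apply: psd_trace_mul_ge0 => //; apply/mxpow_psd/posdef_psd. Qed.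

(** The factor t^(1-p) is absorbed into the power: t^(1-p) (tA + B)^(p-1) = (A + B/t)^(p-1). The
    base decreases in t and the exponent lies in [-1, 0]. *)
Lemma trace_mxpow_ray_mono n (A B : 'M[R]_n) p t u : 0 <= p <= 1 -> psd A -> posdef B ->
  0 < t -> t <= u ->
  t `^ (1 - p) * \tr (mxpow (p - 1) (t *: A + B) *m A) <=
  u `^ (1 - p) * \tr (mxpow (p - 1) (u *: A + B) *m A).
Proof.
move=> hp pA pB t0 tu; have u0 : 0 < u by apply: lt_le_trans tu.
have E v : 0 < v -> v `^ (1 - p) * \tr (mxpow (p - 1) (v *: A + B) *m A) =
    \tr (mxpow (p - 1) (A + v^-1 *: B) *m A).
  move=> v0; have pv : psd (v *: A + B).
    by apply: psdD; [apply: psdZ => //; apply: ltW|exact: posdef_psd].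
  rewrite -mxtraceZ scalemxAl; congr (\tr (_ *m _)).
  have -> : A + v^-1 *: B = v^-1 *: (v *: A + B).
    by rewrite scalerDr scalerA mulVf ?gt_eqF// scale1r.
  rewrite mxpowZ ?invr_ge0 ?(ltW v0)//; congr (_ *: _).
  by rewrite -powR_inv1 ?(ltW v0)// -powRrM mulN1r opprB.
rewrite !E//; apply: trace_mxpow_anti => //.
  by rewrite addrC; apply: posdefDr => //; apply: posdefZ; rewrite ?invr_gt0.
rewrite opprD addrACA subrr add0r -scalerBl; apply: psdZ; last exact: posdef_psd.
by rewrite subr_ge0 lef_pV2 ?posrE.
Qed.

(** The derivative of tr (vA + B)^p is p tr ((vA + B)^(p-1) A), which is at least p k v^(p-1) for v
    >= t, where k is v^(1-p) tr ((vA + B)^(p-1) A) at v = t. So tr (vA + B)^p - k v^p increases on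
    [t, u]. The tangent inequality at the right end of each small interval turns this into a
    quadratic bound on the decrease. *)
Lemma trace_mxpow_increment n (A B : 'M[R]_n) p t u : 0 < p <= 1 -> psd A -> posdef B ->
  0 < t -> t <= u ->
  t `^ (1 - p) * \tr (mxpow (p - 1) (t *: A + B) *m A) * (u `^ p - t `^ p) <=
  \tr (mxpow p (u *: A + B)) - \tr (mxpow p (t *: A + B)).
Proof.
move=> hp pA pB t0 tu; have /andP[p0 p1] := hp.
have hp' : 0 <= p <= 1 by rewrite (ltW p0).
have u0 : 0 < u by apply: lt_le_trans tu.
set k := t `^ _ * _.
have pos v : 0 < v -> posdef (v *: A + B).
  by move=> v0; rewrite addrC; apply: posdefDr => //; apply: psdZ => //; apply: ltW.
have k0 : 0 <= k by apply: mulr_ge0; rewrite ?powR_ge0 //; apply: trace_mxpow_ge0 => //; apply: pos.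
pose g v := \tr (mxpow p (v *: A + B)).
suff : g t - k * t `^ p <= g u - k * u `^ p by rewrite /g mulrBr; lra.
apply: (@le_of_quadratic_decrease _ (fun v => g v - k * v `^ p)
  (p * k * (u `^ p / t ^+ 2))) => // x y tx xy yu.
have x0 : 0 < x by apply: lt_le_trans tx.
have y0 : 0 < y by apply: lt_le_trans xy.
pose ey := \tr (mxpow (p - 1) (y *: A + B) *m A).
have h1 : g x <= g y - p * ey * (y - x).
  have := trace_mxpow_klein hp (pos _ y0) (posdef_psd (pos _ x0)).
  rewrite opprD addrACA subrr addr0 -scalerBl -scalemxAr mxtraceZ -/(g x) -/(g y) -/ey.
  by move/le_trans; apply; rewrite le_eqVlt; apply/orP; left; apply/eqP; ring.
have h2 : k * y `^ (p - 1) <= ey.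
  have : k <= y `^ (1 - p) * ey by apply: trace_mxpow_ray_mono => //; apply: le_trans xy.
  by rewrite -(opprB 1 p) powRN [k * _]mulrC ler_pdivrMl ?powR_gt0.
have h3 := powR_tangent hp x0 (ltW y0).
have xp : x `^ (p - 1) = x `^ p / x.
  by rewrite -(mulr_powRB1 (ltW x0) p0) mulrAC divff ?gt_eqF// mul1r.
have yp : y `^ (p - 1) = y `^ p / y.
  by rewrite -(mulr_powRB1 (ltW y0) p0) mulrAC divff ?gt_eqF// mul1r.
(* Source of the constant u^p / t^2: x^(p-1) - y^(p-1) <= x^p (1/x - 1/y) = x^p (y - x) / (xy), with
   t <= x <= y <= u. *)
have h4 : x `^ (p - 1) - y `^ (p - 1) <= u `^ p / t ^+ 2 * (y - x).
  apply: (@le_trans _ _ (x `^ p * (x^-1 - y^-1))).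
    rewrite xp yp mulrBr lerD2l lerN2 ler_wpM2r ?invr_ge0 ?(ltW y0)//.
    by rewrite ge0_ler_powR ?nnegrE ?(ltW p0) ?(ltW x0) ?(ltW y0).
  have -> : x^-1 - y^-1 = (x * y)^-1 * (y - x).
    by field; rewrite !gt_eqF.
  rewrite mulrA ler_wpM2r ?subr_ge0// ler_pM ?powR_ge0 ?invr_ge0 ?mulr_ge0 ?(ltW x0) ?(ltW y0)//.
    by rewrite ge0_ler_powR ?nnegrE ?(ltW p0) ?(ltW x0) ?(ltW u0)// (le_trans xy).
  rewrite lef_pV2 ?posrE ?mulr_gt0 ?exprn_gt0// expr2 ler_pM ?(ltW t0)//.
  exact: le_trans xy.
have yx0 : 0 <= y - x by rewrite subr_ge0.
have pyx : 0 <= p * (y - x) by rewrite mulr_ge0// ltW.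
have kpyx : 0 <= k * (p * (y - x)) by rewrite mulr_ge0.
have := ler_wpM2l pyx h2; have := ler_wpM2l k0 h3; have := ler_wpM2l kpyx h4.
move: h1; rewrite expr2.
move: (u `^ p / t ^+ 2) (x `^ (p - 1)) (y `^ (p - 1)) (x `^ p) (y `^ p) => K a b c d.
nra.
Qed.

(* C = u^(-p) B - B' is positive, so lowering t only increases the subtracted
   term tr ((tA+B)^(p-1) C). *)
Lemma trace_level_step n (A B B' : 'M[R]_n) p t u : 0 < p <= 1 -> psd A -> posdef B ->
  0 < t -> t <= u -> psd (u `^ (- p) *: B - B') ->
  \tr (mxpow (p - 1) (t *: A + B) *m (t `^ (1 - p) *: A + B')) <=
  \tr (mxpow (p - 1) (u *: A + B) *m (u `^ (1 - p) *: A + B')).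
Proof.
move=> hp pA pB t0 tu pC; have /andP[p0 p1] := hp.
have hp' : 0 <= p <= 1 by rewrite (ltW p0).
have u0 : 0 < u by apply: lt_le_trans tu.
have pos v : 0 < v -> posdef (v *: A + B).
  by move=> v0; rewrite addrC; apply: posdefDr => //; apply: psdZ => //; apply: ltW.
set C := _ - B' in pC.
have BE : B' = u `^ (- p) *: B - C by rewrite /C opprB addrC subrK.
clearbody C.
(* Writing B = (vA + B) - vA leaves three terms: one whose coefficient v^(1-p) - u^(-p) v vanishes
   at v = u, a trace of a p-th power handled by the increment bound, and the term in [C]. *)
have E v : 0 < v -> \tr (mxpow (p - 1) (v *: A + B) *m (v `^ (1 - p) *: A + B')) =
    (v `^ (1 - p) - u `^ (- p) * v) * \tr (mxpow (p - 1) (v *: A + B) *m A)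
    + u `^ (- p) * \tr (mxpow p (v *: A + B))
    - \tr (mxpow (p - 1) (v *: A + B) *m C).
  move=> v0; rewrite -(trace_mxpow_mul _ (pos _ v0)) BE.
  rewrite !mulmxDr mulmxN -!scalemxAr !raddfD !raddfN/= !mxtraceZ; ring.
rewrite !E//.
have : \tr (mxpow (p - 1) (u *: A + B) *m C) <= \tr (mxpow (p - 1) (t *: A + B) *m C).
  apply: trace_mxpow_anti => //; first exact: pos.
  rewrite opprD addrACA subrr addr0 -scalerBl; apply: psdZ => //.
  by rewrite subr_ge0.
have split v : 0 < v -> v `^ (1 - p) * v `^ p = v.
  by move=> v0; rewrite -powRD ?subrK ?powRr1 ?(ltW v0)// ?gt_eqF// ?implybT.
have -> : u `^ (1 - p) - u `^ (- p) * u = 0.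
  rewrite -{3}(split _ u0) mulrCA -powRD; last by rewrite addNr eqxx gt_eqF.
  by rewrite addNr powRr0 mulr1 subrr.
have := trace_mxpow_increment hp pA pB t0 tu.
have up : 0 <= u `^ (- p) by rewrite powR_ge0.
move=> /(ler_wpM2l up).
have upu : u `^ (- p) * u `^ p = 1.
  by rewrite -powRD; [rewrite addNr powRr0|rewrite addNr eqxx gt_eqF].
set e := \tr _; have -> : u `^ (- p) * (t `^ (1 - p) * e * (u `^ p - t `^ p)) =
  (t `^ (1 - p) - u `^ (- p) * t) * e.
  transitivity (t `^ (1 - p) * e * (u `^ (- p) * u `^ p)
                - u `^ (- p) * (t `^ (1 - p) * t `^ p) * e); first ring.
  by rewrite upu split//; ring.
rewrite mulrBr; lra.
Qed.

(** Induction on the sorted list: [A] collects the matrices already raised to the common level t,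
    and each step lifts it to the next level and merges it with the matrix found there. The definite
    [E] sits at the top weight c, so it remains in the complementary part until the last step and
    keeps that part definite. *)
Lemma trace_levels_le n p (E : 'M[R]_n) c (l : seq (R * 'M[R]_n)) (A : 'M[R]_n) t :
  0 < p <= 1 -> posdef E -> 0 < c -> 0 < t -> t <= c -> psd A ->
  path <=%R t (map fst l) -> (forall x, x \in l -> psd x.2 /\ x.1 <= c) ->
  \tr (mxpow (p - 1) (t *: A + (\sum_(x <- l) x.1 *: x.2 + c *: E)) *m
       (t `^ (1 - p) *: A + (\sum_(x <- l) x.1 `^ (1 - p) *: x.2 + c `^ (1 - p) *: E)))
  <= \tr (mxpow p (A + (\sum_(x <- l) x.2 + E))).
Proof.
move=> hp pE c0; have /andP[p0 p1] := hp.
(* In [trace_level_step], [C] combines blocks of weight v >= u with coefficients u^(-p) v - v^(1-p);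
   this is their sign. *)
have powc v u : 0 < u -> u <= v -> v `^ (1 - p) <= u `^ (- p) * v.
  move=> u0 uv; have v0 : 0 < v by apply: lt_le_trans uv.
  have -> : v `^ (1 - p) = v `^ (- p) * v.
    transitivity (v `^ (- p) * v `^ 1); last by rewrite powRr1// ltW.
    by rewrite -powRD ?(addrC 1)// (gt_eqF v0) implybT.
  rewrite ler_wpM2r ?(ltW v0)// !powRN lef_pV2 ?posrE ?powR_gt0//.
  by rewrite ge0_ler_powR ?nnegrE ?(ltW p0) ?(ltW v0) ?(ltW u0).
elim: l A t => [|[u M] l IH] A t t0 tc pA /=.
  move=> _ _; rewrite !big_nil !add0r.
  apply: le_trans (@trace_level_step _ A (c *: E) (c `^ (1 - p) *: E) _ _ c hp pA _ t0 tc _) _.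
  - exact: posdefZ.
  - rewrite scalerA -scalerBl; apply: psdZ; last exact: posdef_psd.
    by rewrite subr_ge0 powc.
  have pAE : posdef (A + E) by rewrite addrC; apply: posdefDr.
  (* All weights now equal c, and the factors c^(p-1) and c^(1-p) cancel. *)
  rewrite -!scalerDr mxpowZ ?(ltW c0)//; last exact: posdef_psd.
  rewrite -scalemxAl -scalemxAr scalerA mxtraceZ -powRD; last by rewrite (gt_eqF c0) implybT.
  by rewrite addrA subrK subrr powRr0 mul1r trace_mxpow_mul.
move=> /andP[tu pl] hl.
have u0 : 0 < u by apply: lt_le_trans tu.
have [pM uc] := hl (u, M) (mem_head _ _).
have hl' x : x \in l -> psd x.2 /\ x.1 <= c by move=> xl; apply: hl; rewrite in_cons xl orbT.
have ul x : x \in l -> u <= x.1.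
  move=> xl; move: pl; rewrite (path_sortedE le_trans) => /andP[/allP h _].
  by apply: h; apply: map_f.
rewrite !big_cons/= -!(addrA _ (\sum_(_ <- _) _)).
apply: le_trans (@trace_level_step _ A (u *: M + (\sum_(x <- l) x.1 *: x.2 + c *: E))
  (u `^ (1 - p) *: M + (\sum_(x <- l) x.1 `^ (1 - p) *: x.2 + c `^ (1 - p) *: E))
  _ _ u hp pA _ t0 tu _) _.
- rewrite addrA addrC; apply: posdefDr; first exact: posdefZ.
  apply: psdD; first by apply: psdZ => //; apply: ltW.
  rewrite big_seq; apply: psd_sum => x xl; apply: psdZ; last by case: (hl' x xl).
  by apply/ltW/(lt_le_trans u0)/ul.
- rewrite !scalerDr !scaler_sumr !opprD addrACA [X in psd (_ + X)]addrACA.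
  rewrite -sumrB !scalerA -!scalerBl.
  apply: psdD; first by apply: psdZ => //; rewrite subr_ge0 powc.
  apply: psdD; last by apply: psdZ; [rewrite subr_ge0 powc|exact: posdef_psd].
  rewrite big_seq; apply: psd_sum => x xl; rewrite scalerA -scalerBl.
  by apply: psdZ; [rewrite subr_ge0 powc// ul|case: (hl' x xl)].
rewrite !(addrA (_ *: A)) -!scalerDr (addrA A).
by apply: IH => //; apply: psdD.
Qed.

End TracePower.

(** * Weighted sums of positive semidefinite matrices *)

Section WeightedSums.
Variable R : realType.
Implicit Types p t u b c : R.

(** After sorting, the chain starts with the zero matrix as lowest block, at the smallest weight, or
    at c if there is no other weight. *)
Lemma weighted_trace_le_posdef n p (E : 'M[R]_n) c (l : seq (R * 'M[R]_n)) :
  0 < p <= 1 -> posdef E -> 0 < c ->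
  (forall x, x \in l -> psd x.2 /\ 0 < x.1 <= c) ->
  \tr (mxpow (p - 1) (\sum_(x <- l) x.1 *: x.2 + c *: E) *m
       (\sum_(x <- l) x.1 `^ (1 - p) *: x.2 + c `^ (1 - p) *: E))
  <= \tr (mxpow p (\sum_(x <- l) x.2 + E)).
Proof.
move=> hp pE c0 hl.
pose le1 (x y : R * 'M[R]_n) := x.1 <= y.1.
have permS := permEl (perm_sort le1 l).
have sortedS : sorted <=%R (map fst (sort le1 l)).
  by rewrite sorted_map; apply: sort_sorted => x y; apply: le_total.
rewrite -!(perm_big _ permS)/=.
have hS x : x \in sort le1 l -> psd x.2 /\ 0 < x.1 <= c by rewrite mem_sort; apply: hl.
case: (sort le1 l) sortedS hS => [|[u M] l'] sl hS.
  have := @trace_levels_le R n p E c [::] 0 c hp pE c0 c0 (lexx _) (@psd0 _ _) isT.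
  by rewrite !scaler0 !add0r; apply.
have [_ /andP[u0 uc]] := hS (u, M) (mem_head _ _).
have := @trace_levels_le R n p E c ((u, M) :: l') 0 u hp pE c0 u0 uc (@psd0 _ _).
rewrite !scaler0 !add0r; apply; first by rewrite /= lexx.
by move=> x /hS[? /andP[]].
Qed.

Lemma le_of_le_affine (x y K : R) : 0 <= K ->
  (forall e, 0 < e -> e <= 1 -> x <= y + e * K) -> x <= y.
Proof.
move=> K0 h; rewrite leNgt; apply/negP => yx.
pose e := (x - y) / (x - y + K + 1).
have d0 : 0 < x - y by rewrite subr_gt0.
have D0 : 0 < x - y + K + 1 by rewrite ltr_wpDl// addr_ge0// ltW.
have e0 : 0 < e by rewrite divr_gt0.
have e1 : e <= 1 by rewrite ler_pdivrMr// mul1r; lra.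
have := h e e0 e1; rewrite leNgt => /negP; apply.
rewrite -ltrBrDl /e mulrAC ltr_pdivrMr// ltr_pM2l//; lra.
Qed.

(* The perturbation d I makes the sum over S definite, at a cost of order d^p. *)
Lemma weighted_trace_le n s p (M : 'I_s -> 'M[R]_n) (w : 'I_s -> R) (S : {set 'I_s}) X :
  0 < p -> p < 1 -> (forall i, psd (M i)) -> (forall i, 0 <= w i) -> posdef X ->
  psd (X - \sum_(i in S) w i *: M i) ->
  \sum_(i in S) w i `^ (1 - p) * \tr (mxpow (p - 1) X *m M i) <=
  \tr (mxpow p (\sum_(i in S) M i)).
Proof.
move=> p0 p1 hM w0 pX XS.
have hp : 0 < p <= 1 by rewrite p0 ltW.
have hp' : 0 <= p <= 1 by rewrite !ltW.
have q0 : 1 - p != 0 by rewrite gt_eqF// subr_gt0.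
pose c := 1 + \sum_i w i.
have sw0 : 0 <= \sum_i w i by rewrite sumr_ge0.
have c0 : 0 < c by rewrite ltr_pwDl.
have wc i : w i <= c.
  rewrite /c (bigD1 i)//= addrCA lerDl addr_ge0// sumr_ge0// => j _; exact: w0.
(* The chain of levels needs positive weights. Zero weights contribute nothing on the left, since
   0^(1-p) = 0 for p < 1, and omitting their matrices only lowers the right-hand side. *)
pose l := [seq (w i, M i) | i <- enum S & 0 < w i].
have lE (V : nmodType) (F : R -> 'M[R]_n -> V) : 
    \sum_(x <- l) F x.1 x.2 = \sum_(i in S | 0 < w i) F (w i) (M i).
  rewrite /l big_map big_filter big_enum_cond/=; apply: eq_bigl => i.
  by [].
have hl x : x \in l -> psd x.2 /\ 0 < x.1 <= c.
  case/(mapP (T1 := 'I_s)) => i; rewrite mem_filter => /andP[wi _] ->.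
  by split; rewrite ?hM//= wi wc.
have wE (V : lmodType R) (f : R -> R) (F : 'I_s -> V) : f 0 = 0 ->
    \sum_(i in S | 0 < w i) f (w i) *: F i = \sum_(i in S) f (w i) *: F i.
  move=> f0; rewrite big_mkcondr/=; apply: eq_bigr => i _; case: ifP => // /negbT.
  rewrite -leNgt => wi; suff -> : w i = 0 by rewrite f0 scale0r.
  by apply/eqP; rewrite eq_le wi w0.
set W := \sum_(i in S) w i `^ (1 - p) *: M i.
have pW : psd W by apply: psd_sum => i _; apply: psdZ; rewrite ?powR_ge0.
have -> : \sum_(i in S) w i `^ (1 - p) * \tr (mxpow (p - 1) X *m M i) = \tr (mxpow (p - 1) X *m W).
  rewrite /W mulmx_sumr raddf_sum/=; apply: eq_bigr => i _.
  by rewrite -scalemxAr mxtraceZ.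
set J := \tr _; set P := \sum_(i in S) M i; set T := \tr _.
have pP : psd P by apply: psd_sum => i _.
have J0 : 0 <= J by apply: trace_mxpow_ge0.
have T0 : 0 <= T.
  by apply: psd_trace_ge0; apply: mxpow_psd.
have [b b0 pXb] := pX.
(* As b I <= X, the perturbation satisfies c e I <= k e X, so the matrix Y below stays under (1 + k
   e) X. *)
pose k := c / b; have k0 : 0 < k by rewrite divr_gt0.
(* The slope comes from (1 + k e) (T + n e) <= T + e (k T + n + k n), valid for e <= 1. *)
apply: (@le_of_le_affine _ _ (k * T + n%:R + k * n%:R)).
  by apply: addr_ge0; [apply: addr_ge0|]; rewrite ?ler0n// mulr_ge0 ?ler0n// ltW.
(* With d^p = e the cost n d^p of the perturbation is linear in e, and still d <= e. *)
move=> e e0 e1; pose d := e `^ p^-1.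
have d0 : 0 < d by rewrite powR_gt0.
have de : d `^ p = e by rewrite -powRrM mulVf ?gt_eqF// powRr1// ltW.
have dle : d <= e.
  have d1 : d <= 1.
    by rewrite -(powRr0 e); apply: ger_powR; rewrite ?e0// invr_ge0 ltW.
  by rewrite -de; apply: ger1_powR; rewrite ?d0// ltW.
have pd : posdef (d%:M : 'M[R]_n) by apply: posdef_scalar.
have := weighted_trace_le_posdef hp pd c0 hl.
rewrite (lE _ (fun a A => a *: A)) (lE _ (fun a A => a `^ (1 - p) *: A)) (lE _ (fun a A => A)).
rewrite (wE _ id)// (wE _ (fun a => a `^ (1 - p))) ?powR0// -/W => hmain.
have h1 : \tr (mxpow p (\sum_(i in S | 0 < w i) M i + d%:M)) <= T + n%:R * e.
  apply: (@le_trans _ _ (\tr (mxpow p (P + d%:M)))).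
    apply: trace_mxpow_mono => //.
    - by apply: psdD; [apply: psd_sum => i _|apply: posdef_psd].
    - by rewrite addrC; apply: posdefDr.
    - rewrite opprD addrACA subrr addr0 /P big_mkcondr/= -sumrB.
      by apply: psd_sum => i _; case: ifP => _; rewrite ?subrr ?subr0//; apply: psd0.
  by rewrite -de; apply: trace_mxpow_shift => //; apply: ltW.
set Y := _ + c *: d%:M in hmain.
have pY : posdef Y.
  rewrite /Y addrC; apply: posdefDr; first exact: posdefZ.
  by apply: psd_sum => i _; apply: psdZ.
have YX : psd ((1 + k * e) *: X - Y).
  rewrite /Y scalerDl scale1r opprD addrACA; apply: psdD => //.
  have -> : (k * e) *: X - c *: d%:M = (k * e) *: (X - b%:M) + (c * (e - d))%:M.
    apply/matrixP => i j; rewrite !mxE -!mulrnAr.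
    case: (i == j); rewrite ?mulr1n ?mulr0n /k; field; exact: lt0r_neq0.
  apply: psdD; first by apply: psdZ => //; rewrite mulr_ge0// ltW.
  by apply: psd_scalar; rewrite mulr_ge0 ?subr_ge0// ltW.
have ke0 : 0 < 1 + k * e by rewrite ltr_pwDl// mulr_ge0// ltW.
have h2 : (1 + k * e)^-1 * J <= \tr (mxpow (p - 1) Y *m W).
  apply: le_trans (trace_mxpow_anti pY YX pW hp').
  rewrite mxpowZ ?(ltW ke0)//; last exact: posdef_psd.
  rewrite -scalemxAl mxtraceZ ler_wpM2r// -powR_inv1 ?(ltW ke0)//.
  by apply: ler_powR; [rewrite lerDl mulr_ge0// ltW|lra].
have h3 : \tr (mxpow (p - 1) Y *m W) <= T + n%:R * e.
  apply: le_trans h1; apply: le_trans hmain.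
  rewrite mulmxDr raddfD/= lerDl -scalemxAr mxtraceZ mulr_ge0 ?powR_ge0//.
  by apply: trace_mxpow_ge0 => //; apply: posdef_psd.
have := le_trans h2 h3; rewrite mulrC ler_pdivrMr// => h4.
apply: le_trans h4 _.
have n0 : 0 <= n%:R :> R by rewrite ler0n.
have := mulr_ge0 (mulr_ge0 (ltW k0) n0) (mulr_ge0 (ltW e0) (_ : 0 <= 1 - e)).
rewrite subr_ge0 => /(_ e1); nra.
Qed.

(** * Rank bounds for the case p = 0 *)

Lemma psd_submx n (A B : 'M[R]_n) : psd A -> psd (B - A) -> (A <= B)%MS.
Proof.
move=> pA /psdP[sBA hBA]; rewrite submxE; apply/eqP/matrixP => i j; rewrite [RHS]mxE.
(* The columns of [cokermx B] lie in the kernel of B, where the form of A <= B must vanish; as A = C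
   C, they are killed by A too. *)
pose x : 'cV[R]_n := cokermx B *m delta_mx j 0.
have Bx : B *m x = 0 by rewrite /x mulmxA mulmx_coker mul0mx.
have [C [CT AE]] := psd_mxfun_sqrt pA.
have Cx : C *m x = 0.
  apply/eqP; rewrite -[_ == 0]negbK; apply/negP => /dotxx_gt0.
  rewrite dot_mulmxl CT mulmxA -AE.
  by have := hBA x; rewrite mulmxBl Bx sub0r -scaleN1r dotZr; lra.
have : A *m x = 0 by rewrite AE -mulmxA Cx mulmx0.
by move=> /(congr1 (fun M : 'cV[R]_n => M i 0)); rewrite /x mulmxA -colE !mxE.
Qed.

(** In a full-rank factorization P = C B, idempotence forces B C to be the identity of size the
    rank. *)
Lemma trace_idempotent n (P : 'M[R]_n) : P *m P = P -> \tr P = (\rank P)%:R.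
Proof.
move=> PP; have := mulmx_base P; have := row_base_free P; have := col_base_full P.
move: (col_base P) (row_base P) => C B fC fB CB.
have BC : B *m C = 1%:M.
  apply: (row_free_inj fB); apply: (row_full_inj fC).
  by rewrite /= mul1mx !mulmxA CB -mulmxA CB.
by rewrite -{1}CB mxtrace_mulC BC mxtrace1.
Qed.

(** The count of nonzero eigenvalues is the trace of the spectral projection A A^+; the convention
    that 0 has inverse 0 makes [x^-1] yield the pseudo-inverse A^+. *)
Lemma sum_nonzero_le_rank n (Q : 'M[R]_n) d A : spectral Q d A ->
  \sum_i (d 0 i != 0)%:R <= (\rank A)%:R :> R.
Proof.
move=> sA; pose f (x : R) : R := (x != 0)%:R.
have symA := spectral_sym sA.
have -> : \sum_i (d 0 i != 0)%:R = \tr (mxfun f A) by rewrite (trmxfun_sum _ sA).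
have PP : mxfun f A *m mxfun f A = mxfun f A.
  rewrite mxfunM// (_ : (fun x => f x * f x) = f)//; apply/funext => x.
  by rewrite /f; case: (x != 0); rewrite ?mulr1 ?mulr0.
have AP : A *m mxfun (fun x => x^-1) A = mxfun f A.
  rewrite -{1}[A]mxfun_id// mxfunM// (_ : (fun x => id x * x^-1) = f)//.
  apply/funext => x; rewrite /f; have [->|x0] := eqVneq x 0; first by rewrite mul0r.
  by rewrite divff.
by rewrite trace_idempotent// ler_nat -AP mxrankM_maxl.
Qed.

(** T = X^(-1/2) Z X^(-1/2) lies between 0 and 1, so its trace is at most its number of nonzero
    eigenvalues; its rank is at most that of Z. *)
Lemma trace_inv_mul_le_rank n (X Z : 'M[R]_n) : posdef X -> psd Z -> psd (X - Z) ->
  \tr (mxpow (- 1) X *m Z) <= (\rank Z)%:R.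
Proof.
move=> pX pZ XZ; have symX := posdef_sym pX.
pose H := mxpow (- (1 / 2)) X.
have sH : H^T = H by rewrite mxpow_sym.
have HH : mxpow (- 1) X = H *m H by rewrite /H mxpowD//; congr (mxpow _ X); field.
have HXH : H *m X *m H = 1%:M.
  transitivity (H *m mxpow 1 X *m H); first by rewrite mxpow1//; apply: posdef_psd.
  rewrite /H !mxpowD//.
  by rewrite (_ : _ + _ = 0) ?mxpow0//; field.
pose T := H *m Z *m H.
have pT : psd T by rewrite /T -{1}sH; apply: psd_conj.
have T1 : psd (1%:M - T).
  rewrite -HXH /T -mulmxBl -mulmxBr -{1}sH; exact: psd_conj.
have [Q [d sT]] := spectral_theorem (proj1 pT).
have -> : \tr (mxpow (- 1) X *m Z) = \sum_i d 0 i.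
  rewrite HH -mulmxA mxtrace_mulC -/T -{1}[T]mxfun_id ?(proj1 pT)//.
  by rewrite (trmxfun_sum _ sT).
apply: (@le_trans _ _ (\rank T)%:R); last first.
  by rewrite ler_nat /T (leq_trans (mxrankM_maxl _ _))// mxrankM_maxr.
apply: le_trans (sum_nonzero_le_rank sT); apply: ler_sum => i _.
have [->//|_] := eqVneq (d 0 i) 0.
by have /(spectral_le _ sT) := T1.
Qed.

End WeightedSums.

(** * Optimal designs *)

Section Designs.
Variable R : realType.
Implicit Types p e b c : R.

Lemma posdef_of_spectral n (Q : 'M[R]_n) d A : spectral Q d A ->
  (forall i, 0 < d 0 i) -> posdef A.
Proof.
move=> sA d0; exists (\big[Order.min/1]_i d 0 i).
  by elim/big_ind: _ => // x y x0 y0; rewrite lt_min x0.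
by apply/(spectral_ge _ sA) => i; apply: bigmin_le.
Qed.

Lemma det_spectral n (Q : 'M[R]_n) d A : spectral Q d A -> \det A = \prod_i d 0 i.
Proof.
move=> [QQ ->]; rewrite !det_mulmx mulrAC -det_mulmx QQ det1 mul1r.
exact: det_diag.
Qed.

Lemma psd_det_posdef n (A : 'M[R]_n) : psd A -> \det A != 0 -> posdef A.
Proof.
move=> pA; have [Q [d sA]] := spectral_theorem (proj1 pA).
rewrite (det_spectral sA) => /prodf_neq0 h.
apply: (posdef_of_spectral sA) => i; rewrite lt_neqAle eq_sym h//.
by have /(spectral_psd sA) := pA; apply.
Qed.

Lemma posdef_det_gt0 n (A : 'M[R]_n) : posdef A -> 0 < \det A.
Proof.
move=> pA; have [Q [d sA]] := spectral_theorem (posdef_sym pA).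
rewrite (det_spectral sA) prodr_gt0// => i _; exact: (posdef_spectral i sA pA).
Qed.

Lemma ln_det n (A : 'M[R]_n) : posdef A -> ln (\det A) = \tr (mxfun (@ln R) A).
Proof.
move=> pA; have [Q [d sA]] := spectral_theorem (posdef_sym pA).
rewrite (det_spectral sA) (trmxfun_sum _ sA).
suff [] : 0 < \prod_i d 0 i /\ ln (\prod_i d 0 i) = \sum_i ln (d 0 i) by [].
elim/big_rec2: _ => [|i x y _ [x0 IH]]; first by rewrite ln1.
have di := posdef_spectral i sA pA.
by rewrite mulr_gt0// lnM ?posrE// IH.
Qed.

Lemma posdef_rank n (A : 'M[R]_n) : posdef A -> \rank A = n.
Proof.
move=> pA; apply/eqP; rewrite -[_ == _]/(row_free A) row_free_unit.
by rewrite unitmxE unitfE gt_eqF// posdef_det_gt0.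
Qed.

Lemma trace_powE p n (A : 'M[R]_n) : p != 0 -> A^T = A ->
  trace_pow p A = \tr (mxpow p A).
Proof.
by move=> /negPf p0 sA; rewrite /trace_pow p0 sum_eigenvalues// mxpowE.
Qed.

Lemma trace_pow_posdef p n (A : 'M[R]_n) : posdef A -> trace_pow p A = \tr (mxpow p A).
Proof.
move=> pA; have sA := posdef_sym pA; have [->|p0] := eqVneq p 0; last exact: trace_powE.
by rewrite /trace_pow eqxx posdef_rank// mxpow0// mxtrace1.
Qed.

Lemma trace_pow_ge0 p n (A : 'M[R]_n) : psd A -> 0 <= trace_pow p A.
Proof.
move=> pA; have [->|p0] := eqVneq p 0; first by rewrite /trace_pow eqxx.
by rewrite trace_powE ?(proj1 pA)// psd_trace_ge0//; apply: mxpow_psd.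
Qed.

Lemma powR_le_inv p x y : 0 < p -> 0 <= x -> 0 <= y -> x `^ p <= y `^ p -> x <= y.
Proof.
move=> p0 x0 y0; apply: contraTT; rewrite -!ltNge => yx.
by rewrite gt0_ltr_powR ?nnegrE.
Qed.

Lemma Phi_le_trace_pow p m (A B : 'M[R]_m) : (0 < m)%N -> 0 < p -> psd A -> psd B ->
  Phi p A <= Phi p B -> trace_pow p A <= trace_pow p B.
Proof.
move=> m0 p0 pA pB; rewrite /Phi (gt_eqF p0).
have mR : 0 < m%:R^-1 :> R by rewrite invr_gt0 ltr0n.
have := trace_pow_ge0 p pA; have := trace_pow_ge0 p pB.
move: (trace_pow p A) (trace_pow p B) => a b b0 a0.
move/powR_le_inv; rewrite invr_gt0 => /(_ p0).
by rewrite ler_pM2l// !mulr_ge0 ?(ltW mR)//; apply.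
Qed.

Lemma posdef_trace_gt0 p n (X A : 'M[R]_n) : (0 < n)%N -> posdef X -> posdef A ->
  0 < \tr (mxpow p X *m A).
Proof.
case: n X A => // n X A _ pX [b b0 pA].
apply: (@lt_le_trans _ _ (\tr (mxpow p X *m b%:M))); last first.
  rewrite -subr_ge0 -raddfB -mulmxBr; exact: trace_mxpow_ge0.
rewrite mul_mx_scalar mxtraceZ mulr_gt0// mxpowE.
have [Q [d sX]] := spectral_theorem (posdef_sym pX).
rewrite (trmxfun_sum _ sX) big_ord_recl ltr_wpDr ?sumr_ge0// => [i _|].
  exact: powR_ge0.
exact/powR_gt0/(posdef_spectral _ sX).
Qed.

Lemma trace_pow_gt0 p n (X : 'M[R]_n) : (0 < n)%N -> posdef X -> 0 < trace_pow p X.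
Proof.
move=> n0 pX; rewrite trace_pow_posdef// -[mxpow p X]mulmx1.
exact: (posdef_trace_gt0 p n0 pX (posdef_scalar _ ltr01)).
Qed.

(** * First-order conditions at an optimal design *)

Variables (m s N : nat) (M : 'I_s -> 'M[R]_m).

Lemma info_psd w : (forall i, psd (M i)) -> (forall i, 0 <= w i) -> psd (info_mx M w).
Proof. by move=> hM w0; apply: psd_sum => i _; apply: psdZ. Qed.

Lemma info_mxD w v a b :
  info_mx M (fun i => a * w i + b * v i) = a *: info_mx M w + b *: info_mx M v.
Proof.
rewrite /info_mx !scaler_sumr -big_split/=; apply: eq_bigr => i _.
by rewrite !scalerA scalerDl.
Qed.

Lemma feasible_convex (w v : 'I_s -> R) e : feasible_design N w -> feasible_design N v ->
  0 <= e <= 1 -> feasible_design N (fun i => (1 - e) * w i + e * v i).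
Proof.
move=> [w0 sw] [v0 sv] /andP[e0 e1]; split=> [i|].
  by rewrite addr_ge0 ?mulr_ge0 ?subr_ge0.
rewrite big_split/= -!mulr_sumr.
have e1' : 0 <= 1 - e by rewrite subr_ge0.
have := ler_wpM2l e1' sw; have := ler_wpM2l e0 sv; lra.
Qed.

(* The derivative is taken at the perturbed point X_e: the tangent there lies
   above the concave objective, whose value at X is at least that at X_e. *)
Lemma optimal_first_order p w v e : (0 < m)%N -> (forall i, psd (M i)) -> 0 <= p <= 1 ->
  optimal_design p N M w -> feasible_design N v -> 0 < e <= 1 ->
  (p = 0 -> posdef (info_mx M w)) ->
  posdef ((1 - e) *: info_mx M w + e *: info_mx M v) ->
  \tr (mxpow (p - 1) ((1 - e) *: info_mx M w + e *: info_mx M v)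
       *m (info_mx M v - info_mx M w)) <= 0.
Proof.
move=> m0 hM /andP[p0 p1] [fw opt] fv /andP[e0 e1] h0 pXe.
have e01 : 0 <= e <= 1 by rewrite ltW.
have := opt _ (feasible_convex fw fv e01); rewrite info_mxD.
set X := info_mx M w in h0 pXe *; set V := info_mx M v in pXe *.
set Xe := (1 - e) *: X + e *: V in pXe *.
have pX : psd X by apply: info_psd => //; case: fw.
suff h : 0 <= \tr (mxpow (p - 1) Xe *m (X - Xe)) -> 
    \tr (mxpow (p - 1) Xe *m (V - X)) <= 0.
  move=> hPhi; apply: h; move: p0; rewrite le_eqVlt => /orP[/eqP p0|p0].
    have pX' := h0 (esym p0); move: hPhi; rewrite -p0 /Phi eqxx => hdet.
    have hd : \det Xe <= \det X.
      by apply: powR_le_inv hdet; rewrite ?invr_gt0 ?ltr0n// ltW// posdef_det_gt0.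
    (* For p = 0 the objective is compared through ln det = tr ln, whose gradient X^(-1) is the case
       p = 0 of X^(p-1). *)
    have : ln (\det Xe) <= ln (\det X) by rewrite ler_ln ?posrE ?posdef_det_gt0.
    rewrite !ln_det// => hln.
    have [P [d sXe]] := spectral_theorem (posdef_sym pXe).
    have [Q [d' sX]] := spectral_theorem (posdef_sym pX').
    have := @trace_klein _ (fun x => 0 < x) (fun x => 0 < x) (@ln R) (fun x => x `^ (0 - 1))
      _ P Q d d' _ _ _ sXe sX _ _.
    rewrite -mxpowE => /(_ _ _ _) hk.
    have : \tr (mxfun (@ln R) X) <= \tr (mxfun (@ln R) Xe) + \tr (mxpow (0 - 1) Xe *m (X - Xe)).
      apply: hk => [x y x0 y0|i|i].
      - by rewrite sub0r powR_inv1 ?(ltW x0)// ln_tangent.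
      - exact: (posdef_spectral i sXe pXe).
      - exact: (posdef_spectral i sX pX').
    by move/(le_trans hln); rewrite lerDl.
  have hp : 0 < p <= 1 by rewrite p0.
  have := Phi_le_trace_pow m0 p0 (posdef_psd pXe) pX hPhi.
  rewrite trace_pow_posdef// trace_powE ?gt_eqF ?(proj1 pX)//.
  move=> /le_trans/(_ (trace_mxpow_klein hp pXe pX)).
  by rewrite lerDl pmulr_rge0.
have -> : X - Xe = - (e *: (V - X)).
  by rewrite /Xe scalerBl scale1r scalerBr -addrA opprD addNKr !opprD opprK addrC.
by rewrite mulmxN -scalemxAr raddfN/= mxtraceZ oppr_ge0 pmulr_rle0.
Qed.

(** For p = 0 a singular matrix has criterion 0. For 0 < p < 1 the slope of tr X^p towards a
    definite V blows up at a singular X: the first-order condition at X_e bounds tr (X_e^(p-1))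
    uniformly in e, which keeps the eigenvalues of X_e away from 0 uniformly in e. *)
Lemma optimal_posdef p w U : (0 < m)%N -> (forall i, psd (M i)) -> 0 <= p < 1 ->
  optimal_design p N M w -> feasible_design N U -> posdef (info_mx M U) ->
  posdef (info_mx M w).
Proof.
move=> m0 hM /andP[p0 p1] hw fU pU.
have pX : psd (info_mx M w) by apply: info_psd => //; case: hw => -[].
move: p0; rewrite le_eqVlt => /orP[/eqP p0|p0].
  apply: psd_det_posdef => //; apply/eqP => det0.
  have [_ /(_ _ fU)] := hw; rewrite -p0 /Phi eqxx det0 powR0 ?invr_eq0 ?pnatr_eq0 -?lt0n//.
  by rewrite leNgt powR_gt0// posdef_det_gt0.
set X := info_mx M w in pX *; set V := info_mx M U in pU *.
have hp : 0 < p <= 1 by rewrite p0 ltW.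
have hp' : 0 <= p <= 1 by rewrite !ltW.
have hp0 : p = 0 -> posdef (info_mx M w) by move=> p00; move: p0; rewrite p00 ltxx.
have [u u0 pVu] := pU.
pose f := \tr (mxpow p X).
have f0 : 0 <= f by apply/psd_trace_ge0/mxpow_psd.
(* Since 1 - e >= 1/2, optimality gives tr (X_e^(p-1) V) <= f / (1 - e) <= 2 f, and V >= u I gives
   tr (X_e^(p-1)) <= 2 f / u; adding 1 makes the bound positive. Then b = B^(-1/(1-p)) bounds the
   eigenvalues from below. *)
pose B := 2 * f / u + 1.
have B0 : 0 < B by rewrite ltr_wpDl// divr_ge0 ?mulr_ge0// ltW.
pose b := (B^-1) `^ ((1 - p)^-1).
have b0 : 0 < b by rewrite powR_gt0// invr_gt0.
have q0 : 0 < 1 - p by rewrite subr_gt0.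
have key e : 0 < e -> e <= 1 / 2 -> psd ((1 - e) *: X + e *: V - b%:M).
  move=> e0 e2; have e1 : 0 < e <= 1 by rewrite e0; lra.
  have ne0 : 0 <= 1 - e by lra.
  set Xe := (1 - e) *: X + e *: V.
  have pXe : posdef Xe.
    by rewrite /Xe addrC; apply: posdefDr; [apply: posdefZ|apply: psdZ].
  have := optimal_first_order m0 hM hp' hw fU e1 hp0 pXe.
  rewrite -/X -/V mulmxBr raddfB/= subr_le0 => h.
  have h1 : \tr (mxpow (p - 1) Xe *m V) <= 2 * f.
    have : (1 - e) * \tr (mxpow (p - 1) Xe *m X) <= f.
      apply: (@le_trans _ _ (\tr (mxpow p Xe))).
        rewrite -(trace_mxpow_mul p pXe) {3}/Xe mulmxDr raddfD/= -scalemxAr mxtraceZ lerDl.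
        by apply: trace_mxpow_ge0 => //; apply: psdZ; [apply: ltW|apply: posdef_psd].
      have e01 : 0 <= e <= 1 by rewrite ltW//; case/andP: e1.
      have [fw opt] := hw; have := opt _ (feasible_convex fw fU e01).
      rewrite info_mxD -/X -/V -/Xe.
      move/(Phi_le_trace_pow m0 p0 (posdef_psd pXe) pX).
      by rewrite trace_pow_posdef// trace_powE ?gt_eqF ?(proj1 pX).
    have : 0 <= \tr (mxpow (p - 1) Xe *m X) by apply: trace_mxpow_ge0.
    move: h e2; move: (\tr _) (\tr _) (f) => a v g; nra.
  have h2 : \tr (mxpow (p - 1) Xe) <= 2 * f / u.
    rewrite ler_pdivlMr//; apply: le_trans h1.
    rewrite mulrC -mxtraceZ -mul_mx_scalar -subr_ge0 -raddfB -mulmxBr.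
    exact: trace_mxpow_ge0.
  have [Q [d sXe]] := spectral_theorem (posdef_sym pXe).
  apply/(spectral_ge _ sXe) => i.
  have di := posdef_spectral i sXe pXe.
  have : d 0 i `^ (p - 1) <= B.
    apply: (@le_trans _ _ (2 * f / u)); last by rewrite /B lerDl.
    apply: le_trans h2; rewrite mxpowE (trmxfun_sum _ sXe) (bigD1 i)//= lerDl.
    by rewrite sumr_ge0// => j _; apply: powR_ge0.
  rewrite -(opprB 1 p) powRN -[B]invrK lef_pV2 ?posrE ?powR_gt0 ?invr_gt0// => h3.
  have -> : d 0 i = (d 0 i `^ (1 - p)) `^ ((1 - p)^-1).
    by rewrite -powRrM mulfV ?gt_eqF// powRr1// ltW.
  by rewrite /b ge0_ler_powR ?nnegrE ?invr_ge0 ?powR_ge0 ?(ltW q0) ?(ltW B0).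
exists b => //; apply/psdP; split=> [|x].
  by rewrite linearB/= tr_scalar_mx (proj1 pX).
(* The margin [b] does not depend on e, so it survives the limit e -> 0. *)
pose c := dot x ((V - X) *m x).
apply: (@le_of_le_affine _ _ _ (2 * `|c|)); first by rewrite mulr_ge0.
move=> e e0 e1; have e20 : 0 < e / 2 by rewrite divr_gt0.
have := key _ e20; rewrite ler_pM2r ?invr_gt0// => /(_ e1) /psdP[_ /(_ x)].
have -> : (1 - e / 2) *: X + (e / 2) *: V - b%:M = X - b%:M + (e / 2) *: (V - X).
  by apply/matrixP => i j; rewrite !mxE; ring.
rewrite mulmxDl dotDr -scalemxAl dotZr -/c => h; apply: le_trans h _.
rewrite lerD2l; have := ler_norm c; have := normr_ge0 c; nra.
Qed.

(** An unspent budget would allow scaling w up by some c > 1, which moves X in the direction (c - 1)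
    X, of strictly positive slope. *)
Lemma optimal_sum p w : (0 < m)%N -> (forall i, psd (M i)) -> 0 <= p <= 1 ->
  optimal_design p N M w -> posdef (info_mx M w) -> \sum_i w i = N%:R.
Proof.
move=> m0 hM hp hw pX; have [[w0 sw] _] := hw; apply/eqP; rewrite eq_le sw leNgt/=.
apply/negP => swN.
have sw0 : 0 < \sum_i w i.
  rewrite lt_neqAle sumr_ge0 ?andbT// eq_sym; apply/eqP => s0.
  have wi0 i : w i = 0.
    have /allP/(_ i (mem_index_enum _))/eqP// : all (fun i => w i == 0) (index_enum 'I_s).
    by have /eqP := s0; rewrite psumr_eq0// => i _; exact: w0.
  have : info_mx M w = 0 by rewrite /info_mx big1// => i _; rewrite wi0 scale0r.
  move: pX => /[swap] -> /posdef_det_gt0.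
  by case: (m) m0 => // k _; rewrite det0 ltxx.
pose c := N%:R / \sum_i w i.
have c1 : 1 < c by rewrite ltr_pdivlMr// mul1r.
have c0 : 0 < c by apply: lt_trans c1.
have fv : feasible_design N (fun i => c * w i).
  split=> [i|]; first by rewrite mulr_ge0// ltW.
  by rewrite -mulr_sumr /c divfK// gt_eqF.
have vE : info_mx M (fun i => c * w i) = c *: info_mx M w.
  by rewrite /info_mx scaler_sumr; apply: eq_bigr => i _; rewrite scalerA.
have := @optimal_first_order p w _ 1 m0 hM hp hw fv _ (fun=> pX).
rewrite subrr scale0r add0r scale1r vE ltr01 lexx => /(_ isT (posdefZ c0 pX)).
have -> : c *: info_mx M w - info_mx M w = (c - 1) *: info_mx M w.
  by rewrite scalerBl scale1r.
apply/negP; rewrite -ltNge -scalemxAr mxtraceZ.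
by rewrite mulr_gt0 ?subr_gt0// posdef_trace_gt0//; apply: posdefZ.
Qed.

(** Written as a perturbation of w so that i = j gives back w and needs no separate treatment. *)
Definition exchange (w : 'I_s -> R) i j : 'I_s -> R :=
  fun k => w k + w i * ((k == j)%:R - (k == i)%:R).

Lemma feasible_exchange w i j : feasible_design N w -> feasible_design N (exchange w i j).
Proof.
move=> [w0 sw]; split=> [k|].
  rewrite /exchange; have [->|ki] := eqVneq k i.
    by rewrite mulrBr mulr1 addrCA subrr addr0 mulr_ge0.
  by rewrite subr0 addr_ge0// mulr_ge0.
rewrite big_split/= -mulr_sumr sumrB.
have E l : \sum_(k < s) (k == l)%:R = 1 :> R.
  by rewrite (bigD1 l)//= eqxx big1 ?addr0// => k /negPf ->.
by rewrite !E subrr mulr0 addr0.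
Qed.

Lemma info_exchange w i j :
  info_mx M (exchange w i j) = info_mx M w + w i *: (M j - M i).
Proof.
have E l : \sum_(k < s) (k == l)%:R *: M k = M l.
  rewrite (bigD1 l)//= eqxx scale1r big1 ?addr0// => k /negPf ->.
  by rewrite scale0r.
rewrite /info_mx -{1}(E j) -{1}(E i) -sumrB scaler_sumr -big_split/=.
apply: eq_bigr => k _.
by rewrite /exchange scalerDl -scalerBl scalerA.
Qed.

(** The first-order condition is available at X_e rather than at X. Sandwiching (1 - e) X <= X_e <=
    (1 + e C) X and using that the power p - 1 reverses the order transfers it to X up to factors
    that tend to 1 with e. *)
Lemma optimal_exchange p w i j : (0 < m)%N -> (forall i, psd (M i)) -> 0 <= p <= 1 ->
  optimal_design p N M w -> posdef (info_mx M w) -> 0 < w i ->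
  \tr (mxpow (p - 1) (info_mx M w) *m M j) <= \tr (mxpow (p - 1) (info_mx M w) *m M i).
Proof.
move=> m0 hM hp hw pX wi.
have fv := feasible_exchange i j (proj1 hw).
have pV : psd (info_mx M (exchange w i j)) by apply: info_psd => //; case: fv.
have VX : info_mx M (exchange w i j) - info_mx M w = w i *: (M j - M i).
  by rewrite info_exchange addrC addKr.
set V := info_mx M (exchange w i j) in pV VX; set X := info_mx M w in pX VX *.
(* This gives V <= (tr V) I <= C X, from b I <= X. *)
have [b b0 pXb] := pX; pose C := \tr V / b.
have C0 : 0 <= C by rewrite divr_ge0 ?psd_trace_ge0// ltW.
have CX : psd (C *: X - V).
  have -> : C *: X - V = C *: (X - b%:M) + ((\tr V)%:M - V).
    rewrite scalerBr scale_scalar_mx /C divfK ?gt_eqF//.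
    by rewrite addrA subrK.
  apply: psdD; first exact: psdZ.
  have [Q [d sV]] := spectral_theorem (proj1 pV).
  apply/(spectral_le _ sV) => k; rewrite -[V]mxfun_id ?(proj1 pV)// (trmxfun_sum _ sV).
  rewrite (bigD1 k)//= lerDl sumr_ge0// => l _.
  by have /(spectral_psd sV) := pV.
pose a k := \tr (mxpow (p - 1) X *m M k).
have a0 k : 0 <= a k by apply: trace_mxpow_ge0.
rewrite -/(a j) -/(a i); apply: (@le_of_le_affine _ _ _ (C * a i + a j)).
  by apply: addr_ge0 (a0 j); apply: mulr_ge0 (a0 i).
move=> e e0; rewrite le_eqVlt => /orP[/eqP ->|e1].
  by have := mulr_ge0 C0 (a0 i); have := a0 i; lra.
have e1' : 0 < 1 - e by rewrite subr_gt0.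
pose Xe := (1 - e) *: X + e *: V.
have pXe : posdef Xe.
  by apply: posdefDr; [exact: posdefZ|apply: psdZ => //; exact: ltW].
have he : 0 < e <= 1 by rewrite e0 ltW.
have := optimal_first_order m0 hM hp hw fv he (fun=> pX) pXe.
rewrite -/X -/V -/Xe VX -scalemxAr mxtraceZ pmulr_rle0// mulmxBr raddfB/= subr_le0 => hji.
have k0 : 0 < 1 + e * C by rewrite ltr_pwDl// mulr_ge0// ltW.
have h1 : \tr (mxpow (p - 1) Xe *m M i) <= (1 - e) `^ (p - 1) * a i.
  rewrite /a -mxtraceZ scalemxAl -mxpowZ ?(ltW e1')//; last exact: posdef_psd.
  apply: trace_mxpow_anti => //; first exact: posdefZ.
  by rewrite /Xe addrAC subrr add0r; apply: psdZ => //; exact: ltW.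
have h2 : (1 + e * C) `^ (p - 1) * a j <= \tr (mxpow (p - 1) Xe *m M j).
  rewrite /a -mxtraceZ scalemxAl -mxpowZ ?(ltW k0)//; last exact: posdef_psd.
  apply: trace_mxpow_anti => //.
  have -> : (1 + e * C) *: X - Xe = e *: (C *: X - V) + e *: X.
    by apply/matrixP => k l; rewrite !mxE; ring.
  by apply: psdD; apply: psdZ => //; [exact: ltW|exact: ltW|exact: posdef_psd].
have {h1 h2 hji} h := le_trans h2 (le_trans hji h1).
(* The sandwich yields a_j <= r^(1-p) a_i; since r >= 1 and 1 - p <= 1, the power can be replaced by
   r itself, which makes the bound affine in e. *)
pose r := (1 + e * C) / (1 - e).
have r0 : 0 < r by rewrite divr_gt0.
have r1 : 1 <= r.
  rewrite ler_pdivlMr// mul1r; have := mulr_ge0 (ltW e0) C0; lra.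
have : a j <= r `^ (1 - p) * a i.
  move: h; rewrite -(opprB 1 p) !powRN ler_pdivrMl ?powR_gt0// => h.
  apply: le_trans h _; rewrite mulrA /r powRM ?invr_ge0 ?(ltW k0) ?(ltW e1')//.
  by rewrite -[(1 - e)^-1]powR_inv1 ?(ltW e1')// powRAC powR_inv1 ?powR_ge0.
have : r `^ (1 - p) <= r by apply: ler1_powR => //; case/andP: hp => ? ?; lra.
move/(ler_wpM2r (a0 i)) => h1 /le_trans/(_ h1).
rewrite /r mulrAC ler_pdivlMr//; lra.
Qed.

End Designs.

(** * Comparison of the rounded set with the optimal design *)

Section Approximation.
Variable R : realType.
Variables (m s N : nat) (M : 'I_s -> 'M[R]_m) (w : 'I_s -> R).
Hypotheses (m0 : (0 < m)%N) (hM : forall i, psd (M i)).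

Lemma phi_set_ge p (S : {set 'I_s}) : 0 <= p < 1 -> (forall i, 0 <= w i) ->
  posdef (info_mx M w) ->
  \sum_(i in S) w i `^ (1 - p) * \tr (mxpow (p - 1) (info_mx M w) *m M i) <= phi_set p M S.
Proof.
move=> /andP[p0 p1] w0 pX; set X := info_mx M w in pX *.
have XS : psd (X - \sum_(i in S) w i *: M i).
  rewrite /X /info_mx (bigID (mem S))/= addrC addrK.
  by apply: psd_sum => i _; apply: psdZ.
have pS : psd (\sum_(i in S) M i) by apply: psd_sum.
move: p0; rewrite le_eqVlt => /orP[/eqP <-|p0]; last first.
  by rewrite /phi_set trace_powE ?gt_eqF ?(proj1 pS)//; apply: weighted_trace_le.
rewrite /phi_set /trace_pow eqxx subr0 sub0r.
set Z := \sum_(i in S) w i *: M i in XS.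
have pZ : psd Z by apply: psd_sum => i _; apply: psdZ.
have -> : \sum_(i in S) w i `^ 1 * \tr (mxpow (- 1) X *m M i) = \tr (mxpow (- 1) X *m Z).
  rewrite /Z mulmx_sumr raddf_sum/=; apply: eq_bigr => i _.
  by rewrite powRr1// -scalemxAr mxtraceZ.
apply: le_trans (trace_inv_mul_le_rank pX pZ XS) _; rewrite ler_nat.
(* Each [M i] with i in S lies below the sum over S, hence so does its row space; weights, even zero
   ones, cannot enlarge the span. *)
apply/mxrankS/summx_sub => i iS; apply: scalemx_sub; apply: psd_submx => //.
by rewrite (bigD1 i)//= addrAC subrr add0r; apply: psd_sum.
Qed.

Lemma phi_set_ge_design p (S : {set 'I_s}) U : 0 <= p < 1 -> (0 < N)%N -> (N <= s)%N ->
  N%:R <= s%:R `^ (1 - p) :> R ->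
  optimal_design p N M w -> feasible_design N U -> posdef (info_mx M U) ->
  largest_coords N w S ->
  (N%:R / s%:R) `^ (1 - p) * phi_design p M w <= phi_set p M S.
Proof.
move=> hp N0 Ns hNs hw fU pU hS.
have hp' : 0 <= p <= 1 by case/andP: hp => -> /ltW ->.
have pX := optimal_posdef m0 hM hp hw fU pU.
have sw := optimal_sum m0 hM hp' hw pX.
have [[w0 _] _] := hw.
pose a i := \tr (mxpow (p - 1) (info_mx M w) *m M i).
have [i0 wi0] : exists i, 0 < w i.
  case: (pselect (exists i, 0 < w i)) => // h; exfalso.
  have : \sum_i w i <= 0.
    by apply: sumr_le0 => i _; rewrite leNgt; apply/negP => wi; apply: h; exists i.
  by rewrite sw lern0; case: N N0.
have ai i : 0 < w i -> a i0 <= a i by move=> wi; apply: (@optimal_exchange R m s N).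
have aj j : a j <= a i0 by apply: (@optimal_exchange R m s N).
have a0 : 0 <= a i0 by apply: trace_mxpow_ge0.
have phiE : phi_design p M w <= N%:R * a i0.
  rewrite /phi_design trace_pow_posdef// -trace_mxpow_mul// {2}/info_mx mulmx_sumr raddf_sum/=.
  rewrite -sw mulr_suml; apply: ler_sum => i _.
  by rewrite -scalemxAr mxtraceZ ler_wpM2l//; apply: aj.
apply: le_trans (phi_set_ge S hp w0 pX).
(* On the support of w each a_i is at least the common value; off it the factor w_i^(1-p) vanishes,
   because p < 1. *)
apply: (@le_trans _ _ (\sum_(i in S) w i `^ (1 - p) * a i0)); last first.
  apply: ler_sum => i _; have := w0 i; rewrite le_eqVlt => /orP[/eqP <-|wi].
    by rewrite powR0 ?mul0r// gt_eqF// subr_gt0; case/andP: hp.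
  by rewrite ler_wpM2l ?powR_ge0// ai.
rewrite -mulr_suml.
apply: le_trans (ler_wpM2l (powR_ge0 _ _) phiE) _.
rewrite mulrA ler_wpM2r// mulrC; apply: sum_powR_largest => //.
by case/andP: hp => p0 p1; rewrite subr_gt0 p1 lerBlDr lerDl.
Qed.

(** With a linear criterion the optimal matrix may be singular, so no negative power of it is used.
    The single selected index has the largest weight, which is positive; moving that weight
    elsewhere cannot help, so its matrix has the largest trace. *)
Lemma phi_set_ge_design_trace (S : {set 'I_s}) U :
  optimal_design 1 1 M w -> feasible_design 1 U -> posdef (info_mx M U) ->
  largest_coords 1 w S -> phi_design 1 M w <= phi_set 1 M S.
Proof.
move=> [fw opt] fU pU [/eqP/cards1P[i SE] hS].
have [w0 sw] := fw.
have trE (A : 'M[R]_m) : psd A -> trace_pow 1 A = \tr A.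
  by move=> pA; rewrite trace_powE ?oner_eq0 ?(proj1 pA)// mxpow1.
have opt' v : feasible_design 1 v -> \tr (info_mx M v) <= \tr (info_mx M w).
  move=> fv; have [v0 _] := fv.
  have := Phi_le_trace_pow m0 ltr01 (info_psd hM v0) (info_psd hM w0) (opt _ fv).
  by rewrite !trE; [|exact: info_psd..].
have wmax j : w j <= w i.
  have [->//|ji] := eqVneq j i.
  by apply: hS; rewrite SE inE ?eqxx.
have wi : 0 < w i.
  rewrite ltNge; apply/negP => wi0.
  have X0 : info_mx M w = 0.
    rewrite /info_mx big1// => j _; suff -> : w j = 0 by rewrite scale0r.
    by apply/eqP; rewrite eq_le w0 (le_trans (wmax j)).
  have := opt' _ fU; rewrite X0 mxtrace0 leNgt => /negP; apply.
  have := posdef_trace_gt0 0 m0 pU pU.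
  by rewrite mxpow0 ?mul1mx//; apply: posdef_sym.
have tj j : \tr (M j) <= \tr (M i).
  have := opt' _ (feasible_exchange i j fw).
  rewrite info_exchange raddfD/= gerDl mxtraceZ pmulr_rle0// raddfB/=.
  by rewrite subr_le0.
rewrite /phi_design /phi_set SE big_set1 !trE//; last exact: info_psd.
rewrite /info_mx raddf_sum/=; apply: (@le_trans _ _ (\sum_j w j * \tr (M i))).
  by apply: ler_sum => j _; rewrite mxtraceZ ler_wpM2l.
by rewrite -mulr_suml ler_piMl// psd_trace_ge0.
Qed.

(** The indicator of [T] is a feasible design. For p = 0 the criterion is a determinant while ranks
    are compared, so optimality gives nothing directly; full rank of the optimal matrix does. *)
Lemma phi_set_le_design p (T : {set 'I_s}) : 0 <= p -> optimal_design p N M w ->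
  (p = 0 -> posdef (info_mx M w)) -> (#|T| <= N)%N ->
  phi_set p M T <= phi_design p M w.
Proof.
move=> p0 [[w0 _] opt] h0 TN.
have pT : psd (\sum_(i in T) M i) by apply: psd_sum.
move: p0; rewrite le_eqVlt => /orP[/eqP p0|p0].
  rewrite /phi_design /phi_set -p0 /trace_pow eqxx ler_nat (posdef_rank (h0 (esym p0))).
  exact: rank_leq_row.
pose v i : R := (i \in T)%:R.
have v0 i : 0 <= v i by rewrite ler0n.
have vE : info_mx M v = \sum_(i in T) M i.
  rewrite /info_mx [RHS]big_mkcond; apply: eq_bigr => i _.
  by rewrite /v; case: (i \in T); rewrite ?scale1r ?scale0r.
have fv : feasible_design N v.
  split=> //; rewrite /v -natr_sum ler_nat; apply: leq_trans TN.
  by rewrite -sum1_card [leqRHS]big_mkcond; apply: leq_sum => i _; case: (i \in T).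
have := Phi_le_trace_pow m0 p0 (info_psd hM v0) (info_psd hM w0) (opt _ fv).
by rewrite vE.
Qed.

End Approximation.

Theorem theorem3p7 (R : realType) (m s N : nat) (M : 'I_s -> 'M[R]_m) (p : R)
    (w : 'I_s -> R) (S Sopt : {set 'I_s})
    (hm : (0 < m)%N) (hs : (2 <= s)%N)
    (hM : forall i, psd (M i))
    (hrank : \rank (\sum_(i < s) M i)%R = m)
    (hp : 0 <= p <= 1)
    (hN : (1 <= N <= s)%N)
    (hw : optimal_design p N M w)
    (hS : largest_coords N w S)
    (hSopt : optimal_set p N M Sopt)
    (hpN : p <= 1 - ln (N%:R : R) / ln (s%:R : R)) :
  phi_set p M S / phi_set p M Sopt >= phi_set p M S / phi_design p M w /\
  phi_set p M S / phi_design p M w >= (N%:R / s%:R) `^ (1 - p).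
Proof.
have /andP[p0 p1] := hp; have /andP[N0 Ns] := hN.
have sR : 0 < s%:R :> R by rewrite ltr0n (leq_trans _ hs).
have NR : 0 < N%:R :> R by rewrite ltr0n.
(* The uniform design is feasible, and definite by the rank hypothesis; it is the reference point
   for definiteness and positivity. *)
pose U (i : 'I_s) : R := N%:R / s%:R.
have UE : info_mx M U = (N%:R / s%:R) *: \sum_(i < s) M i.
  by rewrite /info_mx scaler_sumr.
have fU : feasible_design N U.
  split=> [i|]; first by rewrite divr_ge0.
  by rewrite sumr_const card_ord -[leLHS]mulr_natr divfK// gt_eqF.
have pU : posdef (info_mx M U).
  rewrite UE; apply: posdefZ; first by rewrite divr_gt0.
  apply: psd_det_posdef; first exact: psd_sum.
  by rewrite -unitfE -unitmxE -row_free_unit /row_free hrank.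
have [w0 _] := hw.1.
have lns : 0 < ln (s%:R : R) by rewrite ln_gt0// ltr1n.
(* The condition on p in multiplicative form; ln s > 0 because s >= 2. *)
have hNs : N%:R <= s%:R `^ (1 - p) :> R.
  rewrite -ler_ln ?posrE ?powR_gt0// ln_powR -ler_pdivrMr//; lra.
have hX0 : p < 1 -> posdef (info_mx M w).
  by move=> plt; apply: (optimal_posdef hm hM _ hw fU pU); rewrite p0.
have lower : (N%:R / s%:R) `^ (1 - p) * phi_design p M w <= phi_set p M S.
  move: p1; rewrite le_eqVlt => /orP[/eqP p1|p1]; last first.
    by apply: (phi_set_ge_design hm hM _ N0 Ns hNs hw fU pU hS); rewrite p0.
  (* At p = 1 the condition becomes N <= s^0 = 1. *)
  move: hNs; rewrite p1 subrr !powRr0 lern1 => N1.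
  have {}N1 : N = 1%N by apply/eqP; rewrite eqn_leq N1.
  subst N p; rewrite mul1r.
  exact: (phi_set_ge_design_trace hm hM hw fU pU hS).
have upper : phi_set p M Sopt <= phi_design p M w.
  apply: (phi_set_le_design hm hM p0 hw); last by case: hSopt.
  by move=> pz; apply: hX0; rewrite pz.
have SSopt : phi_set p M S <= phi_set p M Sopt.
  by case: hSopt => _; apply; case: hS => ->.
(* For p > 0 positivity comes from the uniform design, which also covers p = 1, where the optimal
   matrix may be singular. *)
have dpos : 0 < phi_design p M w.
  rewrite /phi_design; have [pz|pnz] := eqVneq p 0.
    by apply: trace_pow_gt0 => //; apply: hX0; rewrite pz.
  have pgt : 0 < p by rewrite lt_neqAle eq_sym pnz.
  apply: (lt_le_trans (trace_pow_gt0 p hm pU)).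
  by apply: (Phi_le_trace_pow hm pgt (posdef_psd pU) (info_psd hM w0)); apply: hw.2.
have Npos : 0 < (N%:R / s%:R) `^ (1 - p) :> R by rewrite powR_gt0// divr_gt0.
have Spos : 0 < phi_set p M S by apply: lt_le_trans lower; rewrite mulr_gt0.
move: lower upper SSopt dpos Spos.
move: (phi_set p M S) (phi_set p M Sopt) (phi_design p M w) => a b d.
move=> lower upper SSopt dpos Spos; split; last by rewrite ler_pdivlMr.
rewrite ler_wpM2l ?(ltW Spos)// lef_pV2 ?posrE//.
exact: lt_le_trans SSopt.
Qed.
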